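(* For all $m\in\mathbb Z_+$ we have $P_m^{+\,\prime}=P_m^+$. In particular, $\langle P_m^+,P_n^+\rangle=\bigl(P_m^+,P_n^+\bigr)=0$ for $m,n\in\mathbb Z_+$ with $m\neq n$.
   Context: $\mathbb Z_+=\{0,1,2,\dots\}$. Parameters: $q\in\mathbb C$ with $0<|q|<1$ and a fixed square root $q^{1/2}$; $\underline t=(k_0,k_1,u_0,u_1)$ nonzero complex numbers with $k_0^2,k_1^2,u_1^2\notin\{\pm q^j:j\in\mathbb Z\}$. Set $a=k_1u_1$, $b=-k_1u_1^{-1}$, $c=q^{1/2}k_0u_0$, $d=-q^{1/2}k_0u_0^{-1}$ and assume $ef\notin q^{\mathbb Z}$ for all $e,f\in\{a,b,c,d\}$. $\mathcal A=\mathbb C[x^{\pm1}]$. Define linear operators on $\mathcal A$ by $(T_1f)(x)=k_1f(x)+k_1^{-1}\frac{(1-k_1u_1x)(1+k_1u_1^{-1}x)}{1-x^2}\bigl(f(x^{-1})-f(x)\bigr)$ and $(T_0f)(x)=k_0f(x)+k_0^{-1}\frac{(1-q^{1/2}k_0u_0x^{-1})(1+q^{1/2}k_0u_0^{-1}x^{-1})}{1-qx^{-2}}\bigl(f(qx^{-1})-f(x)\bigr)$, and $Y=T_1T_0$. Let $\epsilon(m)=1$ for $m\ge0$, $\epsilon(m)=-1$ for $m<0$, $\gamma_m=(k_0k_1)^{\epsilon(m)}q^m$. Order the monomials by $1\prec x^{-1}\prec x\prec x^{-2}\prec x^2\prec\cdots$. $P_m$ ($m\in\mathbb Z$) is the unique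 Laurent polynomial of the form $x^m+$ lower order terms w.r.t. $\preceq$ with $YP_m=\gamma_mP_m$. The symmetric Askey-Wilson polynomial $P_m^+$ ($m\in\mathbb Z_+$) is the unique element of $\mathrm{span}\{P_m,P_{-m}\}$ of the form $x^m+$ lower order terms with $T_1P_m^+=k_1P_m^+$. $P_m^{+\,\prime}$ denotes the polynomial obtained by the same construction with $k_0,k_1,u_0,u_1,q,q^{1/2}$ all replaced by their inverses. $(y;q)_\infty=\prod_{j\ge0}(1-yq^j)$ and $(y_1,\dots,y_r;q)_\infty=\prod_i(y_i;q)_\infty$. The bilinear forms on $\mathcal A$ are $$\langle f,g\rangle=\frac1{2\pi i}\int_{C}f(x)g(x^{-1})\Delta(x)\frac{dx}{x},\qquad (f,g)=\frac1{2\pi i}\int_{C}f(x)g(x^{-1})\Delta_+(x)\frac{dx}{x},$$ $$\Delta_+(x)=\frac{(x^2,x^{-2};q)_\infty}{(ax,ax^{-1},bx,bx^{-1},cx,cx^{-1},dx,dx^{-1};q)_\infty},\qquad \Delta(x)=\frac{(1-ax^{-1})(1-bx^{-1})}{1-x^{-2}}\Delta_+(x),$$ where $C$ is a counterclockwise continuous rectifiable Jordan curve such that $aq^k,bq^k,cq^k,dq^k$ ($k\in\mathbb Z_+$) lie in its interior and $a^{-1}q^{-k},b^{-1}q^{-k},c^{-1}q^{-k},d^{-1}q^{-k}$ ($k\in\mathbb Z_+$) lie in its exterior. *)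

(* Defs.v *)
(* The field of complex numbers is R[i], for R : realType. *)
From HB Require Import structures.
From mathcomp Require Import all_boot all_order all_algebra finmap.
From mathcomp Require Import all_classical all_reals all_analysis.
From mathcomp.real_closed Require Import complex.
(* the notations of monalg clash with those of MathComp-Analysis *)
From mathcomp.multinomials Require Import -(notations) monalg.
Set Implicit Arguments.
Unset Strict Implicit.
Unset Printing Implicit Defensive.
Import Order.TTheory GRing.Theory Num.Theory numFieldNormedType.Exports.
Local Open Scope classical_set_scope.
Local Open Scope complex_scope.
Local Open Scope ring_scope.

(* [sq] is the chosen square root q^{1/2}. *)
Record params (R : realType) := Params {
  k0 : R[i]; k1 : R[i]; u0 : R[i]; u1 : R[i]; sq : R[i]
}.

Section ParameterSets.
Context {R : realType}.
Implicit Type t : params R.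

Definition q_ t : R[i] := sq t ^+ 2.

Definition inv_params t : params R :=
  Params (k0 t)^-1 (k1 t)^-1 (u0 t)^-1 (u1 t)^-1 (sq t)^-1.

Definition a_ t : R[i] := k1 t * u1 t.
Definition b_ t : R[i] := - (k1 t * (u1 t)^-1).
Definition c_ t : R[i] := sq t * k0 t * u0 t.
Definition d_ t : R[i] := - (sq t * k0 t * (u0 t)^-1).
Definition abcd t : seq R[i] := [:: a_ t; b_ t; c_ t; d_ t].

Definition admissible t : Prop :=
  [/\ 0 < `|q_ t| < 1,
      [/\ k0 t != 0, k1 t != 0, u0 t != 0 & u1 t != 0],
      (forall (x : R[i]) (j : int), x \in [:: k0 t; k1 t; u1 t] ->
         x ^+ 2 != q_ t ^ j /\ x ^+ 2 != - q_ t ^ j)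
    & (forall (e f : R[i]) (j : int), e \in abcd t -> f \in abcd t ->
         e * f != q_ t ^ j)].

End ParameterSets.

(* C[x, x^-1] as finitely supported functions int -> C: [mcoeff j f] is the
   coefficient of x^j in f, and [lev f x] is the value of f at x != 0. *)
Notation laurent R := (malg int R[i]).

Section LaurentPolynomials.
Context {R : realType}.
Implicit Types (t : params R) (f g p : laurent R) (m j : int).

Definition lev f (x : R[i]) : R[i] := \sum_(j <- msupp f) mcoeff j f * x ^ j.

(* A Laurent polynomial is determined by its values off a finite set, and the
   singularities of the right-hand sides of the next two formulas, at x^2 = 1
   and at x^2 = q, are removable: in each case exactly one g qualifies. *)
Definition T1 t f : laurent R := xget 0 [set g : laurent R |
  forall x : R[i], x != 0 -> x ^+ 2 != 1 ->
    lev g x = k1 t * lev f x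
      + (k1 t)^-1
        * ((1 - k1 t * u1 t * x) * (1 + k1 t * (u1 t)^-1 * x) / (1 - x ^+ 2))
        * (lev f x^-1 - lev f x)].

Definition T0 t f : laurent R := xget 0 [set g : laurent R |
  forall x : R[i], x != 0 -> x ^+ 2 != q_ t ->
    lev g x = k0 t * lev f x
      + (k0 t)^-1
        * ((1 - sq t * k0 t * u0 t * x^-1)
           * (1 + sq t * k0 t * (u0 t)^-1 * x^-1) / (1 - q_ t * x ^- 2))
        * (lev f (q_ t * x^-1) - lev f x)].

Definition Y t f : laurent R := T1 t (T0 t f).

Definition eps m : int := if 0 <= m then 1 else -1.
Definition gamma_ t m : R[i] := (k0 t * k1 t) ^ eps m * q_ t ^ m.

(* Position of x^m in the list 1, x^-1, x, x^-2, x^2, ...; recall that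
   [Negz n] is -(n+1). *)
Definition mrank m : nat :=
  match m with Posz n => n.*2 | Negz n => n.*2.+1 end.
Definition mprec j m : bool := (mrank j < mrank m)%N.

Definition leading m p : Prop :=
  mcoeff m p = 1 /\ forall j, j != m -> mcoeff j p != 0 -> mprec j m.

Definition is_P t m p : Prop :=
  unique (fun f => leading m f /\ Y t f = gamma_ t m *: f) p.

Definition is_Pplus t (m : nat) p : Prop :=
  exists Pm Pmm : laurent R,
    [/\ is_P t m%:Z Pm, is_P t (- m%:Z) Pmm
      & unique (fun f => [/\ exists al be : R[i], f = al *: Pm + be *: Pmm,
                             leading m%:Z f & T1 t f = k1 t *: f]) p].

End LaurentPolynomials.

Section ContourIntegral.
Context {R : realType}.
Implicit Types (C : R -> R[i]) (s : seq R) (F : R[i] -> R[i]) (w : R[i]).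

Definition node s (i : nat) : R := nth 1 (0 :: s) i.

Definition rectifiable C : Prop :=
  exists L : R, forall s, itv_partition 0 1 s ->
    \sum_(0 <= i < size s) `|C (node s i.+1) - C (node s i)| <= L%:C.

Definition jordan_curve C : Prop :=
  [/\ {within `[0, 1], continuous (C : R -> R[i]^o)}, C 0 = C 1
    & forall x y : R, 0 <= x < 1 -> 0 <= y < 1 -> C x = C y -> x = y].

Definition on_curve C w : Prop := exists2 x : R, 0 <= x <= 1 & C x = w.

Definition component C w : set R[i]^o :=
  connected_component [set z : R[i]^o | ~ on_curve C z] w.
Definition interior_pt C w : Prop :=
  ~ on_curve C w /\ bounded_set (component C w).
Definition exterior_pt C w : Prop :=
  ~ on_curve C w /\ ~ bounded_set (component C w).

(* The integral of F(z) dz along C exists as a limit of Riemann-Stieltjes sums,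
   and equals v. *)
Definition is_cint C F (v : R[i]) : Prop :=
  forall e : R, 0 < e -> exists2 d : R, 0 < d &
    forall s (xi : nat -> R), itv_partition 0 1 s ->
      (forall i, (i < size s)%N -> node s i <= xi i <= node s i.+1) ->
      (forall i, (i < size s)%N -> node s i.+1 - node s i < d) ->
      `|\sum_(0 <= i < size s) F (C (xi i)) * (C (node s i.+1) - C (node s i))
        - v| < e%:C.

Definition twopii : R[i] := (0 +i* (2 * pi))%C.

Definition counterclockwise C : Prop :=
  forall w, interior_pt C w -> is_cint C (fun z => (z - w)^-1) twopii.

End ContourIntegral.

Section BilinearForms.
Context {R : realType}.
Implicit Types (t : params R) (C : R -> R[i]) (f g : laurent R) (x y : R[i]).

Definition qpoch1 (q : R[i]) y : R[i] :=
  limn (fun n : nat => \prod_(0 <= j < n) (1 - y * q ^+ j) : R[i]^o).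
Definition qpoch (q : R[i]) (ys : seq R[i]) : R[i] :=
  \prod_(y <- ys) qpoch1 q y.

Definition Delta_plus t x : R[i] :=
  qpoch (q_ t) [:: x ^+ 2; x ^- 2]
  / qpoch (q_ t) [:: a_ t * x; a_ t * x^-1; b_ t * x; b_ t * x^-1;
                     c_ t * x; c_ t * x^-1; d_ t * x; d_ t * x^-1].

(* The singularities at x = 1 and x = -1 are removable. If C passes through
   one of them, the value 0 given there by division by zero does not affect
   the integral, since C meets each of them for finitely many arguments. *)
Definition Delta t x : R[i] :=
  (1 - a_ t * x^-1) * (1 - b_ t * x^-1) / (1 - x ^- 2) * Delta_plus t x.

(* That 0 is not on the curve is implicit in the forms: the integrands are
   defined on the complement of 0 only. *)
Definition admissible_contour t C : Prop :=
  [/\ jordan_curve C, rectifiable C, counterclockwise C, ~ on_curve C 0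
    & forall (e : R[i]) (k : nat), e \in abcd t ->
        interior_pt C (e * q_ t ^+ k) /\ exterior_pt C (e^-1 * q_ t ^- k)].

Definition is_pairing C (W : R[i] -> R[i]) f g (v : R[i]) : Prop :=
  is_cint C (fun x => lev f x * lev g x^-1 * W x / x) (twopii * v).

Definition is_form t C f g v : Prop := is_pairing C (Delta t) f g v.
Definition is_form_plus t C f g v : Prop := is_pairing C (Delta_plus t) f g v.

End BilinearForms.

(* Main.v *)
Require Import Defs.
From mathcomp Require Import all_boot all_order all_algebra finmap.
From mathcomp Require Import all_classical all_reals all_analysis.
From mathcomp.real_closed Require Import complex.
From mathcomp.multinomials Require Import -(notations) monalg.
From mathcomp Require Import ring lra zify.
Import Order.TTheory GRing.Theory Num.Theory numFieldNormedType.Exports.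
Import ComplexField.Normc.
Set Implicit Arguments.
Unset Strict Implicit.
Unset Printing Implicit Defensive.
Local Open Scope classical_set_scope.
Local Open Scope ring_scope.

(** The symmetric polynomials P_m^+ are eigenfunctions of Y + Y^-1, which acts
on Laurent polynomials invariant under x -> 1/x as the second order
Askey-Wilson difference operator. That operator is only multiplied by a constant
when all parameters are inverted, and a coincidence of its eigenvalues would
contradict the uniqueness of P_m or of P_{-m}.

For the orthogonality, put w = Delta_+. The eigenvalue equations turn a nonzero
multiple of P_m^+ P_n^+ w into K_1 + K_2, where K_1(1/(qx)) = - K_1(x) and
K_2(q/x) = - K_2(x); similarly the antisymmetric part of Delta/Delta_+ is odd
under x -> 1/x. It remains to see that an F with F(ka/x) = - F(x), whose poles
in C^* are points p inside C and the points ka/p outside C, satisfies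
int_C F(x) dx/x = 0. For rational F this follows from partial fractions, since
int_C G(x) dx/x = int_C G(ka/x) dx/x for G(x) = (1 - p/x)^(-k) and G(x) = x^k.
Truncating all infinite products after n factors preserves the oddness exactly,
and the truncations converge uniformly on C. *)

(** * Continuous functions on a closed curve *)

(** The contour is only a rectifiable Jordan curve and need not be stable under x -> ka/x, so the
    invariance of an integral under that map is a fact about residues, not a change of variables. No
    general Cauchy theorem is involved. What is integrated in closed form is either the derivative
    of a power of a Moebius map, which gives 0 on a closed curve avoiding its pole, or 1/(z - w).
    For the latter, the value at interior w is the orientation hypothesis, the value 0 at exterior w
    follows by connectedness, and w = 0 is a limit of the interior points a q^k.

    K_1 and K_2 arise by multiplying the equation of P_m^+ by P_n^+ w and that of P_n^+ by P_m^+ w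
    and subtracting: the products P_m^+(x) P_n^+(x) cancel on the left, the terms at qx form K_1,
    those at x/q form K_2. Their poles are points e q^k inside and e^-1 q^-k outside, and x ->
    1/(qx), x -> q/x exchange these families with k shifted by one.

    For the first assertion, the difference of the two polynomials has exponents strictly between -m
    and m, hence below both x^m and x^-m. *)

Section Norm.
Context {R : realType}.
Implicit Types x y : R[i].
Local Notation N := (@normc R).

Lemma normr_normc x : `|x| = (N x)%:C%C. Proof. by []. Qed.

Lemma normc_ge0 x : 0 <= N x.
Proof. by rewrite -lecR -normr_normc normr_ge0. Qed.

Lemma norm0c : N 0 = 0. Proof. exact: normc0. Qed.

Lemma norm1c : N 1 = 1. Proof. exact: normc1. Qed.

Lemma normc_eq0 x : (N x == 0) = (x == 0).
Proof. by apply/eqP/eqP => [/eq0_normc //|->]; exact: normc0. Qed.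

Lemma normc_gt0 x : (0 < N x) = (x != 0).
Proof. by rewrite lt_def normc_ge0 andbT normc_eq0. Qed.

Lemma normcB x y : N (x - y) = N (y - x).
Proof. by rewrite -normcN opprB. Qed.

Lemma normcX x n : N (x ^+ n) = N x ^+ n.
Proof. by elim: n => [|n IH]; rewrite ?expr0 ?norm1c // !exprS normcM IH. Qed.

Lemma normc_sum (I : Type) (s : seq I) (P : pred I) (F : I -> R[i]) :
  N (\sum_(i <- s | P i) F i) <= \sum_(i <- s | P i) N (F i).
Proof.
elim/big_rec2: _ => [|i y1 y2 _ IH]; first by rewrite le_eqVlt normc_eq0 eqxx.
by apply: (le_trans (le_normcD _ _)); rewrite lerD2l.
Qed.

Lemma ler_normcB x y : N x - N y <= N (x - y).
Proof. by rewrite lerBlDr -{1}(subrK y x) le_normcD. Qed.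

End Norm.

Section Curve.
Context {R : realType}.
Variable C : R -> R[i].
Local Notation N := (@normc R).
Hypothesis jC : jordan_curve C.

Lemma curve_continuous x e : 0 <= x <= 1 -> 0 < e ->
  exists2 d : R, 0 < d & forall s, 0 <= s <= 1 -> `|s - x| < d -> N (C s - C x) < e.
Proof.
move=> x01 e0; case: jC => /subspace_continuousP/(_ x) Cx _ _.
have /Cx/cvgrPdist_lt /(_ e%:C%C) : `[0, 1]%classic x by rewrite /= in_itv.
rewrite ltcR => /(_ e0); rewrite near_withinE => -[d /= d0 H].
exists d => // s s01 sx; have := H s; rewrite /= in_itv /= s01 normcB.
rewrite normr_normc ltcR normcB; apply => //.
by rewrite distrC.
Qed.

Lemma near_dist (x d : R) : 0 < d -> \forall x' \near x, `|x - x'| < d.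
Proof. by move=> d0; exact: (nbhsx_ballx x d d0). Qed.

(** Compactness of [0, 1] with a parameter running along a filter: F at infinity yields uniform
    bounds, F at 0+ yields uniform moduli of continuity and lower bounds. *)
Lemma curve_compact (I : Type) (F : set_system I) (P : I -> R -> Prop) :
  Filter F ->
  (forall x : R, 0 <= x <= 1 ->
     \forall x' \near x & i \near F, (0 <= x' <= 1 -> P i x')) ->
  \forall i \near F, forall x : R, 0 <= x <= 1 -> P i x.
Proof.
move=> FF H; have /compact_near_coveringP
  /(_ I F (fun i x => 0 <= x <= 1 -> P i x) FF) := @segment_compact R 0 1.
move=> K; near=> i => x x01.
suff : (`[0, 1]%classic `<=` (fun x : R => (0 <= x <= 1 -> P i x)%R))%classic.
  by apply; rewrite //= in_itv.
near: i; apply: K => y /=.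
by rewrite in_itv; exact: H.
Unshelve. all: by end_near.
Qed.


(** Only values along the curve enter. The bound is carried along for the sake of products. *)
Definition unif_cont (h : R[i] -> R[i]) : Prop :=
  (exists B, forall z, on_curve C z -> N (h z) <= B) /\
  forall e, 0 < e -> exists2 d : R, 0 < d & forall s t, 0 <= s <= 1 ->
    0 <= t <= 1 -> `|s - t| < d -> N (h (C s) - h (C t)) < e.

Lemma unif_cont_id : unif_cont id.
Proof.
split.
  have : \forall B \near +oo, forall x, 0 <= x <= 1 -> N (C x) <= B.
    apply: curve_compact => x x01.
    have [d d0 Hd] := curve_continuous x01 (ltr01 : 0 < 1 :> R).
    near=> x' B => /= x'01.
    have : N (C x' - C x) < 1.
      apply: Hd => //; rewrite distrC; near: x'; exact: near_dist.
    have := ler_normcB (C x') (C x).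
    have : 1 + N (C x) <= B by near: B; apply: nbhs_pinfty_ge; exact: num_real.
    lra.
  by move=> [B [_ /(_ (B + 1))]] H; exists (B + 1) => _ [x x01 <-]; apply: H => //; lra.
move=> e e0.
have : \forall d \near 0^'+, forall x, 0 <= x <= 1 ->
    forall t, 0 <= t <= 1 -> `|x - t| < d -> N (C x - C t) < e.
  apply: curve_compact => x x01.
  have e2 : 0 < e / 2 by lra.
  have [d d0 Hd] := curve_continuous x01 e2.
  have d2 : 0 < d / 2 by lra.
  near=> x' d' => /= x'01 t t01 xt.
  have x'x : `|x - x'| < d / 2.
    near: x'; exact: near_dist.
  have dd : d' < d / 2 by near: d'; apply: nbhs_right_lt.
  have H1 : N (C x' - C x) < e / 2 by apply: Hd => //; rewrite distrC; lra.
  have H2 : N (C t - C x) < e / 2.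
    apply: Hd => //; have := ler_normD (t - x') (x' - x).
    by rewrite subrKA (distrC t x') (distrC x' x); lra.
  rewrite normcB in H2; have := le_normcD (C x' - C x) (C x - C t).
  rewrite subrKA; lra.
(* [d] is the radius of a punctured right neighbourhood of 0, so a point strictly inside it has to
   be chosen. *)
move=> [d /= d0 H]; exists (d / 2) => [|s t s01 t01 st]; first lra.
apply: (H (d / 2)) => //=; last lra.
rewrite sub0r normrN gtr0_norm; lra.
Unshelve. all: by end_near.
Qed.

Lemma unif_cont_cst c : unif_cont (fun=> c).
Proof.
by split; [exists (N c)|move=> e e0; exists 1 => // *; rewrite subrr norm0c].
Qed.

Lemma unif_contD g h :
  unif_cont g -> unif_cont h -> unif_cont (fun z => g z + h z).
Proof.
move=> [[A HA] Hg] [[B HB] Hh]; split.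
  exists (A + B) => z Cz; apply: (le_trans (le_normcD _ _)).
  by apply: lerD; [apply: HA|apply: HB].
move=> e e0; have e2 : 0 < e / 2 by lra.
have [d1 d10 H1] := Hg _ e2; have [d2 d20 H2] := Hh _ e2.
exists (Num.min d1 d2) => [|s t s01 t01]; first by rewrite lt_min d10.
rewrite lt_min => /andP[st1 st2].
rewrite opprD addrACA; apply: (le_lt_trans (le_normcD _ _)).
by have := H1 _ _ s01 t01 st1; have := H2 _ _ s01 t01 st2; lra.
Qed.

Lemma bounded_pos (h : R[i] -> R[i]) :
  (exists B, forall z, on_curve C z -> N (h z) <= B) ->
  exists2 B, 0 < B & forall z, on_curve C z -> N (h z) <= B.
Proof.
move=> [B H]; exists (`|B| + 1) => [|z /H]; first by have := normr_ge0 B; lra.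
by have := ler_norm B; lra.
Qed.

Lemma unif_contM g h :
  unif_cont g -> unif_cont h -> unif_cont (fun z => g z * h z).
Proof.
move=> [/bounded_pos[A A0 HA] Hg] [/bounded_pos[B B0 HB] Hh]; split.
  exists (A * B) => z Cz; rewrite normcM.
  by apply: ler_pM; rewrite ?normc_ge0 ?HA ?HB.
move=> e e0; have eA : 0 < e / (A + A) by rewrite divr_gt0; lra.
have eB : 0 < e / (B + B) by rewrite divr_gt0; lra.
have [d1 d10 H1] := Hg _ eB; have [d2 d20 H2] := Hh _ eA.
exists (Num.min d1 d2) => [|s t s01 t01]; first by rewrite lt_min d10.
rewrite lt_min => /andP[st1 st2].
have -> : g (C s) * h (C s) - g (C t) * h (C t) =
  (g (C s) - g (C t)) * h (C s) + g (C t) * (h (C s) - h (C t)) by ring.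
apply: (le_lt_trans (le_normcD _ _)); rewrite !normcM.
have h1 : N (g (C s) - g (C t)) * N (h (C s)) <= e / (B + B) * B.
  apply: ler_pM; rewrite ?normc_ge0 ?HB ?ltW ?H1 //; by exists s.
have h2 : N (g (C t)) * N (h (C s) - h (C t)) < A * (e / (A + A)).
  apply: (@le_lt_trans _ _ (A * N (h (C s) - h (C t)))).
    by rewrite ler_wpM2r ?normc_ge0 ?HA //; exists t.
  by rewrite ltr_pM2l // H2.
have : e / (B + B) * B = e / 2 by field; lra.
have : A * (e / (A + A)) = e / 2 by field; lra.
lra.
Qed.

Lemma unif_contX g n : unif_cont g -> unif_cont (fun z => g z ^+ n).
Proof.
move=> Hg; elim: n => [|n IH]; first exact: unif_cont_cst.
rewrite (_ : (fun z => _) = (fun z => g z * g z ^+ n)); first exact: unif_contM.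
by apply/funext => z; rewrite exprS.
Qed.

Lemma unif_contV g d : 0 < d -> (forall z, on_curve C z -> d <= N (g z)) ->
  unif_cont g -> unif_cont (fun z => (g z)^-1).
Proof.
move=> d0 Hd [_ Hg]; split.
  by exists d^-1 => z Cz; rewrite normcV lef_pV2 ?posrE ?Hd //; apply: lt_le_trans (Hd _ Cz).
move=> e e0; have e1 : 0 < e * (d * d) by rewrite !mulr_gt0.
have [d1 d10 H1] := Hg _ e1; exists d1 => // s t s01 t01 st.
have [Ds Dt] : d <= N (g (C s)) /\ d <= N (g (C t)).
  by split; apply: Hd; [exists s|exists t].
have [gs gt] : g (C s) != 0 /\ g (C t) != 0.
  by rewrite -!normc_gt0; split; lra.
have -> : (g (C s))^-1 - (g (C t))^-1 =
  (g (C t) - g (C s)) / (g (C s) * g (C t)) by field; apply/andP.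
have dd : d * d <= N (g (C s)) * N (g (C t)) by apply: ler_pM; lra.
rewrite normcM normcV normcM ltr_pdivrMr; last by apply: lt_le_trans dd; rewrite mulr_gt0.
rewrite normcB; apply: (lt_le_trans (H1 _ _ s01 t01 st)).
by rewrite ler_pM2l.
Qed.

Lemma curve_min h : unif_cont h -> (forall z, on_curve C z -> h z != 0) ->
  exists2 d : R, 0 < d & forall z, on_curve C z -> d <= N (h z).
Proof.
move=> [_ Hh] nz.
have : \forall d \near 0^'+, forall x, 0 <= x <= 1 -> d <= N (h (C x)).
  apply: curve_compact => x x01.
  have e0 : 0 < N (h (C x)) / 2 by rewrite divr_gt0 // normc_gt0 nz //; exists x.
  have [d d0 Hd] := Hh _ e0.
  near=> x' d' => /= x'01.
  have x'x : `|x - x'| < d.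
    near: x'; exact: near_dist.
  have dd : d' < N (h (C x)) / 2 by near: d'; apply: nbhs_right_lt.
  have := Hd _ _ x01 x'01 x'x.
  have := ler_normcB (h (C x)) (h (C x')); lra.
move=> [d /= d0 H]; exists (d / 2) => [|_ [x x01 <-]]; first lra.
apply: (H (d / 2)) => //=; last lra.
rewrite sub0r normrN gtr0_norm; lra.
Unshelve. all: by end_near.
Qed.

Lemma curve_dist w : ~ on_curve C w ->
  exists2 d : R, 0 < d & forall z, on_curve C z -> d <= N (z - w).
Proof.
move=> Cw; apply: curve_min => [|z Cz].
  by apply: unif_contD; [exact: unif_cont_id|exact: unif_cont_cst].
by rewrite subr_eq0; apply/eqP => E; apply: Cw; rewrite -E.
Qed.

End Curve.

(** * Contour integrals *)

Section ContourIntegrals.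
Context {R : realType}.
Variable C : R -> R[i].
Local Notation N := (@normc R).
Hypothesis jC : jordan_curve C.
Hypothesis rC : rectifiable C.
Implicit Types (F G : R[i] -> R[i]) (s : seq R) (xi : nat -> R).

Lemma node_itv s i : itv_partition 0 1 s -> 0 <= node s i <= 1.
Proof.
move=> Hs; rewrite /node; case: i => [|i] /=; first by rewrite lexx ler01.
have [si|si] := ltnP i (size s); last by rewrite nth_default // ler01 lexx.
have h : (i.+1 < (size s).+1)%N by [].
have := itv_partition_nth_ge h Hs.
have := itv_partition_nth_le h Hs.
by move=> /= -> ->.
Qed.

Lemma rectifiableP : exists2 L : R, 0 < L & forall s, itv_partition 0 1 s ->
  \sum_(0 <= i < size s) N (C (node s i.+1) - C (node s i)) <= L.
Proof.
case: rC => L HL; exists (`|L| + 1) => [|s /HL]; first by have := normr_ge0 L; lra.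
rewrite (_ : \sum_(0 <= i < size s) _ =
  (\sum_(0 <= i < size s) N (C (node s i.+1) - C (node s i)))%:C%C).
  by rewrite lecR => H; apply: (le_trans H); have := ler_norm L; lra.
by rewrite rmorph_sum.
Qed.

Lemma cintP F v : is_cint C F v <-> forall e : R, 0 < e -> exists2 d : R, 0 < d &
  forall s xi, itv_partition 0 1 s ->
    (forall i, (i < size s)%N -> node s i <= xi i <= node s i.+1) ->
    (forall i, (i < size s)%N -> node s i.+1 - node s i < d) ->
    N (\sum_(0 <= i < size s) F (C (xi i)) * (C (node s i.+1) - C (node s i)) - v)
      < e.
Proof.
split=> H e e0; have [d d0 Hd] := H _ e0; exists d => // s xi Hs Hxi Hm.
  by have := Hd _ _ Hs Hxi Hm; rewrite normr_normc ltcR.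
by rewrite normr_normc ltcR; apply: Hd.
Qed.

Lemma tag_itv s xi : itv_partition 0 1 s ->
  (forall i, (i < size s)%N -> node s i <= xi i <= node s i.+1) ->
  forall i, (i < size s)%N -> 0 <= xi i <= 1.
Proof.
move=> Hs Hxi i si; have /andP[h1 h2] := Hxi i si.
have /andP[h3 _] := node_itv i Hs; have /andP[_ h4] := node_itv i.+1 Hs.
by rewrite (le_trans h3 h1) (le_trans h2 h4).
Qed.

Lemma cint_ext F G v : (forall z, on_curve C z -> F z = G z) ->
  is_cint C F v -> is_cint C G v.
Proof.
move=> FG /cintP H; apply/cintP => e e0; have [d d0 Hd] := H _ e0.
exists d => // s xi Hs Hxi Hm; have := Hd _ _ Hs Hxi Hm.
congr (N (_ - v) < e); apply: eq_big_nat => i /andP[_ si].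
by rewrite FG //; exists (xi i) => //; apply: tag_itv si.
Qed.

Lemma cintD F G v w : is_cint C F v -> is_cint C G w ->
  is_cint C (fun z => F z + G z) (v + w).
Proof.
move=> /cintP HF /cintP HG; apply/cintP => e e0; have e2 : 0 < e / 2 by lra.
have [d1 d10 H1] := HF _ e2; have [d2 d20 H2] := HG _ e2.
exists (Num.min d1 d2) => [|s xi Hs Hxi Hm]; first by rewrite lt_min d10.
have [m1 m2] : (forall i, (i < size s)%N -> node s i.+1 - node s i < d1) /\
    (forall i, (i < size s)%N -> node s i.+1 - node s i < d2).
  by split=> i /Hm; rewrite lt_min => /andP[].
have h1 := H1 _ _ Hs Hxi m1; have h2 := H2 _ _ Hs Hxi m2.
under eq_bigr do rewrite mulrDl.
rewrite big_split /= opprD addrACA.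
by apply: (le_lt_trans (le_normcD _ _)); lra.
Qed.

Lemma cintZ a F v : is_cint C F v -> is_cint C (fun z => a * F z) (a * v).
Proof.
move=> /cintP HF; apply/cintP => e e0.
have Na := normc_ge0 a; have a0 : 0 < N a + 1 by lra.
have ea : 0 < e / (N a + 1) by rewrite divr_gt0.
have [d d0 Hd] := HF _ ea; exists d => // s xi Hs Hxi Hm.
have := Hd _ _ Hs Hxi Hm; rewrite ltr_pdivlMr // => h.
under eq_bigr do rewrite -mulrA.
rewrite -mulr_sumr -mulrBr normcM mulrC; apply: le_lt_trans h.
by rewrite ler_wpM2l ?normc_ge0 //; lra.
Qed.

Lemma cint0 : is_cint C (fun=> 0) 0.
Proof.
apply/cintP => e e0; exists 1 => // s xi _ _ _.
by rewrite big1 => [|i _]; rewrite ?mul0r // subrr norm0c.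
Qed.

Lemma cintB F G v w : is_cint C F v -> is_cint C G w ->
  is_cint C (fun z => F z - G z) (v - w).
Proof.
move=> HF /(cintZ (-1)) HG; rewrite -[- w]mulN1r.
by apply: cint_ext (cintD HF HG) => z _; rewrite mulN1r.
Qed.

Lemma cint_sum n (F : nat -> R[i] -> R[i]) (v : nat -> R[i]) :
  (forall k, (k < n)%N -> is_cint C (F k) (v k)) ->
  is_cint C (fun z => \sum_(k < n) F k z) (\sum_(k < n) v k).
Proof.
elim: n => [|n IH] H.
  by rewrite big_ord0; apply: cint_ext cint0 => z _; rewrite big_ord0.
rewrite big_ord_recr /=.
have := cintD (IH (fun k kn => H k (ltnW kn))) (H n (ltnSn n)).
by apply: cint_ext => z _; rewrite big_ord_recr.
Qed.

(** Riemann-Stieltjes sums of F and G differ by at most sup |F - G| times a bound L on the length of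
    C, whence the tolerance e / (2L). Existence of the integral of F is part of the conclusion. *)
Lemma cint_lim F v : (forall e : R, 0 < e -> exists2 G, is_cint C G v &
    forall z, on_curve C z -> N (F z - G z) <= e) -> is_cint C F v.
Proof.
move=> H; apply/cintP => e e0; have [L L0 HL] := rectifiableP.
have e1 : 0 < e / (L + L) by rewrite divr_gt0; lra.
have e2 : 0 < e / 2 by lra.
have [G /cintP HG FG] := H _ e1; have [d d0 Hd] := HG _ e2.
exists d => // s xi Hs Hxi Hm; have h1 := Hd _ _ Hs Hxi Hm.
rewrite -(subrKA (\sum_(0 <= i < size s) G (C (xi i)) * (C (node s i.+1) - C (node s i)))).
apply: (le_lt_trans (le_normcD _ _)); rewrite -sumrB.
suff : N (\sum_(0 <= i < size s) (F (C (xi i)) * (C (node s i.+1) - C (node s i)) -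
    G (C (xi i)) * (C (node s i.+1) - C (node s i)))) <= e / 2 by lra.
apply: (le_trans (normc_sum _ _ _)).
apply: (@le_trans _ _ (\sum_(0 <= i < size s) (e / (L + L)) *
   N (C (node s i.+1) - C (node s i)))).
  rewrite !big_nat; apply: ler_sum => i /andP[_ si].
  rewrite -mulrBl normcM ler_wpM2r ?normc_ge0 // FG //.
  by exists (xi i) => //; apply: tag_itv si.
rewrite -mulr_sumr (@le_trans _ _ (e / (L + L) * L)) //.
  by rewrite ler_pM2l // HL.
by rewrite le_eqVlt; apply/orP; left; apply/eqP; field; lra.
Qed.

Lemma node_le s i : itv_partition 0 1 s -> (i < size s)%N ->
  node s i <= node s i.+1.
Proof.
move=> [Hs _] si; rewrite /node /=.
have := (pathP 1 Hs) i si; exact: ltW.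
Qed.

(* Telescoping: the Riemann-Stieltjes sums of f are close to those of the
   increments of g, which vanish on a closed curve. *)
Lemma cint_exact (g f : R[i] -> R[i]) :
  (forall e : R, 0 < e -> exists2 d : R, 0 < d & forall s t r : R,
     0 <= s <= 1 -> 0 <= t <= 1 -> 0 <= r <= 1 -> `|s - r| < d -> `|t - r| < d ->
     N (g (C t) - g (C s) - f (C r) * (C t - C s)) <= e * N (C t - C s)) ->
  is_cint C f 0.
Proof.
move=> H; apply/cintP => e e0; have [L L0 HL] := rectifiableP.
have e1 : 0 < e / (L + L) by rewrite divr_gt0; lra.
have [d d0 Hd] := H _ e1; exists d => // s xi Hs Hxi Hm; rewrite subr0.
have T : \sum_(0 <= i < size s) (g (C (node s i.+1)) - g (C (node s i))) = 0.
  rewrite telescope_sumr // /node /=.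
  have := itv_partition_nth_size 1 Hs; move=> /= ->.
  by case: jC => _ -> _; rewrite subrr.
set S := (X in N X); rewrite -normcN -sub0r -T /S -sumrB; apply: (le_lt_trans (normc_sum _ _ _)).
apply: (@le_lt_trans _ _ (\sum_(0 <= i < size s) (e / (L + L)) *
   N (C (node s i.+1) - C (node s i)))).
  rewrite !big_nat; apply: ler_sum => i /andP[_ si].
  have /andP[x1 x2] := Hxi _ si; have m := Hm _ si; have l := node_le Hs si.
  apply: Hd; rewrite ?node_itv ?(tag_itv Hs Hxi) //.
    by rewrite ltr_norml; apply/andP; split; lra.
  by rewrite ltr_norml; apply/andP; split; lra.
rewrite -mulr_sumr (@le_lt_trans _ _ (e / (L + L) * L)) //.
  by rewrite ler_pM2l // HL.
have -> : e / (L + L) * L = e / 2 by field; lra.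
lra.
Qed.

End ContourIntegrals.

(** * Exact forms and winding numbers *)

Section Winding.
Context {R : realType}.
Variable C : R -> R[i].
Local Notation N := (@normc R).
Hypothesis jC : jordan_curve C.
Hypothesis rC : rectifiable C.
Implicit Types (F G : R[i] -> R[i]).

(** Prepares [cint_moebius]: the divided difference of a power is a sum of products of a function of
    C t and a function of C s, to be compared with its diagonal value at C r. *)
Lemma unif_cont_diag n (X Y : nat -> R[i] -> R[i]) (e : R) :
  (forall i, unif_cont C (X i)) -> (forall i, unif_cont C (Y i)) -> 0 < e ->
  exists2 d : R, 0 < d & forall s t r : R, 0 <= s <= 1 -> 0 <= t <= 1 ->
    0 <= r <= 1 -> `|s - r| < d -> `|t - r| < d ->
    N (\sum_(i < n) (X i (C t) * Y i (C s) - X i (C r) * Y i (C r))) <= e.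
Proof.
move=> HX HY; elim: n e => [|n IH] e e0.
  by exists 1 => // *; rewrite big_ord0 norm0c ltW.
have e2 : 0 < e / 2 by lra.
have [d1 d10 H1] := IH _ e2.
have [/bounded_pos[A A0 HA] UX] := HX n; have [/bounded_pos[B B0 HB] UY] := HY n.
have eA : 0 < e / (4 * A) by rewrite divr_gt0; lra.
have eB : 0 < e / (4 * B) by rewrite divr_gt0; lra.
have [d2 d20 H2] := UX _ eB; have [d3 d30 H3] := UY _ eA.
exists (Num.min d1 (Num.min d2 d3)) => [|s t r s01 t01 r01].
  by rewrite !lt_min d10 d20.
rewrite !lt_min => /and3P[s1 s2 s3] /and3P[t1 t2 t3].
rewrite big_ord_recr /=; apply: (le_trans (le_normcD _ _)).
have h1 := H1 _ _ _ s01 t01 r01 s1 t1.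
have -> : X n (C t) * Y n (C s) - X n (C r) * Y n (C r) =
   (X n (C t) - X n (C r)) * Y n (C s) + X n (C r) * (Y n (C s) - Y n (C r)).
  by ring.
have h2 : N ((X n (C t) - X n (C r)) * Y n (C s)) <= e / (4 * B) * B.
  rewrite normcM; apply: ler_pM; rewrite ?normc_ge0 //.
    by apply/ltW/H2.
  by apply: HB; exists s.
have h3 : N (X n (C r) * (Y n (C s) - Y n (C r))) <= A * (e / (4 * A)).
  rewrite normcM; apply: ler_pM; rewrite ?normc_ge0 //.
    by apply: HA; exists r.
  by apply/ltW/H3.
have h4 : e / (4 * B) * B = e / 4 by field; rewrite gt_eqF.
have h5 : A * (e / (4 * A)) = e / 4 by field; rewrite gt_eqF.
have := le_normcD ((X n (C t) - X n (C r)) * Y n (C s))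
  (X n (C r) * (Y n (C s) - Y n (C r))).
lra.
Qed.

(** For y = (al z + be) / (ga z + de) one has y' = (al de - be ga) / (ga z + de)^2, so the integrand
    is a constant multiple of the derivative of y^(k+1). This family covers z^k, (z - w)^(-k-2) and
    the exact forms needed for poles of higher order. *)
Lemma cint_moebius (al be ga de : R[i]) k : al * de - be * ga != 0 ->
  (forall z, on_curve C z -> ga * z + de != 0) ->
  is_cint C (fun z => ((al * z + be) / (ga * z + de)) ^+ k
                      / (ga * z + de) ^+ 2) 0.
Proof.
move=> D0 nz.
have UA b c : unif_cont C (fun z => b * z + c).
  apply: unif_contD; last exact: unif_cont_cst.
  by apply: unif_contM; [exact: unif_cont_cst|exact: unif_cont_id].
have [c c0 Hc] : exists2 c : R, 0 < c & forall z, on_curve C z -> c <= N (ga * z + de).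
  have [g0|g0] := eqVneq ga 0.
    have := nz _ (ex_intro2 _ _ 0 (_ : 0 <= 0 <= 1) erefl).
    rewrite g0 mul0r add0r lexx ler01 => /(_ isT) de0.
    by exists (N de) => [|z _]; rewrite ?normc_gt0 // mul0r add0r.
  have [|d d0 Hd] := @curve_dist R C jC (- (de / ga)).
    move=> /nz; rewrite mulrN mulrCA divff // mulr1 addNr eqxx //.
  exists (N ga * d) => [|z /Hd]; first by rewrite mulr_gt0 // normc_gt0.
  rewrite -(ler_pM2l (_ : 0 < N ga)) ?normc_gt0 // -normcM.
  by congr (_ <= N _); field.
pose m z := (ga * z + de)^-1; pose y z := (al * z + be) * m z.
have Um : unif_cont C m by apply: unif_contV (UA _ _); [exact: c0|].
have Uy : unif_cont C y by apply: unif_contM.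
have UX i : unif_cont C (fun z => m z * y z ^+ i).
  by apply: unif_contM => //; apply: unif_contX.
have k0 : (k.+1)%:R != 0 :> R[i] by rewrite pnatr_eq0.
suff : is_cint C (fun z => (al * de - be * ga) * (k.+1%:R * (y z ^+ k * m z ^+ 2))) 0.
  move=> /(cintZ ((al * de - be * ga) * k.+1%:R)^-1); rewrite mulr0.
  apply: cint_ext => z Cz; rewrite -[X in _ = X ^+ k / _]/(y z) -exprVn -/(m z).
  by move: k0; move: (k.+1%:R) => K k0; field; rewrite k0.
apply: (@cint_exact _ _ jC rC (fun z => y z ^+ k.+1)) => e e0.
have De : 0 < N (al * de - be * ga) by rewrite normc_gt0.
have e1 : 0 < e / N (al * de - be * ga) by rewrite divr_gt0.
have [d d0 Hd] := @unif_cont_diag k.+1 (fun i z => m z * y z ^+ (k - i))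
  (fun i z => m z * y z ^+ i) _ (fun i => UX _) (fun i => UX _) e1.
exists d => // s t r s01 t01 r01 sr tr.
have := Hd _ _ _ s01 t01 r01 sr tr.
rewrite ler_pdivlMr // -normcM => H.
set S := \sum_(_ < _) _ in H.
(* The increment of y is exactly (al de - be ga) m(C t) m(C s) (C t - C s), so the error of the
   primitive is divisible by C t - C s, with cofactor the deviation [S] from the diagonal. *)
suff -> : y (C t) ^+ k.+1 - y (C s) ^+ k.+1 - (al * de - be * ga) *
    (k.+1%:R * (y (C r) ^+ k * m (C r) ^+ 2)) * (C t - C s) =
    S * (al * de - be * ga) * (C t - C s).
  by rewrite normcM ler_wpM2r // normc_ge0.
have -> : S = (\sum_(i < k.+1) y (C t) ^+ (k - i) * y (C s) ^+ i) * (m (C t) * m (C s))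
   - k.+1%:R * (y (C r) ^+ k * m (C r) ^+ 2).
  rewrite /S sumrB mulr_suml; congr (_ - _).
    by apply: eq_bigr => i _; rewrite mulrACA mulrC.
  rewrite (eq_bigr (fun=> y (C r) ^+ k * m (C r) ^+ 2)).
    by rewrite sumr_const card_ord mulr_natl.
  move=> i _; have ik : (i <= k)%N by rewrite -ltnS.
  by rewrite mulrACA mulrC -exprD subnK // expr2.
rewrite subrXX /=.
have -> : y (C t) - y (C s) = (al * de - be * ga) * (m (C t) * m (C s)) * (C t - C s).
  rewrite /y /m; field.
  by apply/andP; split; apply: nz; [exists s|exists t].
rewrite (eq_bigr (fun i : 'I_k.+1 => y (C t) ^+ (k - i) * y (C s) ^+ i)) //.
by ring.
Qed.

Lemma cint_expr k : is_cint C (fun z => z ^+ k) 0.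
Proof.
apply: cint_ext (@cint_moebius 1 0 0 1 k _ _) => [z _||z _].
- by rewrite !mul1r mul0r addr0 add0r expr1n !divr1.
- by rewrite mul0r subr0 mulr1 oner_eq0.
- by rewrite mul0r add0r oner_eq0.
Qed.

Lemma cint_exprV w k : ~ on_curve C w ->
  is_cint C (fun z => (z - w) ^- k.+2) 0.
Proof.
move=> Cw; apply: cint_ext (@cint_moebius 0 1 1 (- w) k _ _) => [z _||z Cz].
- by rewrite !mul1r mul0r add0r mul1r exprVn -invfM -exprD addn2.
- by rewrite mul0r mul1r sub0r oppr_eq0 oner_eq0.
- by rewrite mul1r subr_eq0; apply/eqP => E; apply: Cw; rewrite -E.
Qed.

(* v is 2 pi i times the winding number of C around w. *)
Definition winding w v := is_cint C (fun z => (z - w)^-1) v.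

Lemma geometric_small (e : R) : 0 < e -> exists n, 2^-1 ^+ n <= e.
Proof.
move=> e0; have := @cvg_expr R (2^-1); rewrite ger0_norm; last lra.
have h1 : 2^-1 < 1 :> R by lra.
move=> /(_ h1) /cvgrPdist_le /(_ _ e0) [n _ /(_ n (leqnn n))].
by rewrite sub0r normrN ger0_norm ?exprn_ge0 //; exists n.
Qed.

(** Expand 1/(z - w) in powers of (w - w0)/(z - w0), of modulus at most 1/2 on the curve: each term
    after 1/(z - w0) has a pole of order at least 2 and integrates to 0. *)
Lemma winding_shift w0 w (d : R) v : 0 < d ->
  (forall z, on_curve C z -> d <= N (z - w0)) -> N (w - w0) <= d / 2 ->
  winding w0 v -> winding w v.
Proof.
move=> d0 Hd ww H; apply: cint_lim => // e e0.
have [n Hn] : exists n, 2^-1 ^+ n <= e * (d / 2).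
  by apply: geometric_small; rewrite mulr_gt0 //; lra.
have C0 : ~ on_curve C w0 by move=> /Hd; rewrite subrr norm0c; lra.
exists (fun z => \sum_(k < n.+1) (w - w0) ^+ k * (z - w0) ^- k.+1).
  have -> : v = v + 0 by rewrite addr0.
  have : is_cint C (fun z => (z - w0)^-1 +
      \sum_(k < n) (w - w0) ^+ k.+1 * (z - w0) ^- k.+2) (v + \sum_(k < n) 0).
    apply: cintD => //; apply: (cint_sum (v := fun=> 0)
      (F := fun k z => (w - w0) ^+ k.+1 * (z - w0) ^- k.+2)) => k _.
    have := cintZ ((w - w0) ^+ k.+1) (@cint_exprV w0 k C0).
    by rewrite mulr0.
  rewrite big1 //; apply: cint_ext => z _.
  by rewrite big_ord_recl expr0 mul1r expr1.
move=> z Cz; have zw0 := Hd _ Cz.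
have zw : d / 2 <= N (z - w).
  have := le_normcD (z - w) (w - w0); rewrite subrKA; lra.
have n0 : z - w0 != 0 by rewrite -normc_gt0; lra.
have n1 : z - w != 0 by rewrite -normc_gt0; lra.
pose r := (w - w0) / (z - w0).
have -> : (z - w)^-1 - \sum_(k < n.+1) (w - w0) ^+ k * (z - w0) ^- k.+1 =
    r ^+ n.+1 / (z - w).
  have r1 : 1 - r != 0.
    rewrite /r (_ : 1 - _ = (z - w) / (z - w0)); last by field.
    by rewrite mulf_neq0 ?invr_eq0.
  have -> : \sum_(k < n.+1) (w - w0) ^+ k * (z - w0) ^- k.+1 =
     (z - w0)^-1 * \sum_(k < n.+1) r ^+ k.
    rewrite mulr_sumr; apply: eq_bigr => k _.
    by rewrite /r expr_div_n exprS invfM mulrCA.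
  have /esym := subrX1 r n.+1; rewrite -opprB -[RHS]opprB mulNr => /oppr_inj E.
  have -> : \sum_(k < n.+1) r ^+ k = (1 - r ^+ n.+1) / (1 - r).
    by rewrite -E mulrAC divff // mul1r.
  have -> : (z - w)^-1 = (z - w0)^-1 / (1 - r).
    by rewrite -invfM /r; congr (_^-1); field.
  by field; rewrite r1.
have rN : N r <= 2^-1.
  rewrite normcM normcV ler_pdivrMr; last by lra.
  by apply: (le_trans ww); lra.
rewrite normcM normcV normcX ler_pdivrMr; last by lra.
apply: (@le_trans _ _ (2^-1 ^+ n)).
  apply: (@le_trans _ _ (2^-1 ^+ n.+1)).
    by rewrite lerXn2r ?nnegrE ?normc_ge0 //; lra.
  by rewrite exprS ger_pMl ?exprn_gt0 //; lra.
by apply: (le_trans Hn); rewrite ler_pM2l.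
Qed.

(** Expand 1/(z - w) in powers of z/w, of modulus at most 1/2 on the curve: the partial sums are
    polynomials in z and integrate to 0. *)
Lemma winding_far w (M : R) : 0 < M -> (forall z, on_curve C z -> N z <= M) ->
  2 * M <= N w -> winding w 0.
Proof.
move=> M0 HM Mw; apply: cint_lim => // e e0.
have [n Hn] : exists n, 2^-1 ^+ n <= e * M.
  by apply: geometric_small; rewrite mulr_gt0 //; lra.
have w0 : w != 0 by rewrite -normc_gt0; lra.
exists (fun z => \sum_(k < n) (- w ^- k.+1) * z ^+ k).
  have := @cint_sum _ C n (fun k z => (- w ^- k.+1) * z ^+ k) (fun=> 0).
  rewrite big1 //; apply => k _.
  by have := cintZ (- w ^- k.+1) (cint_expr k); rewrite mulr0.
move=> z Cz; have zM := HM _ Cz.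
have zw : M <= N (z - w).
  have := le_normcD (w - z) z; rewrite subrK normcB; lra.
have n1 : z - w != 0 by rewrite -normc_gt0; lra.
pose r := z / w.
have -> : (z - w)^-1 - \sum_(k < n) (- w ^- k.+1) * z ^+ k =
    r ^+ n / (z - w).
  have r1 : r - 1 != 0.
    rewrite /r (_ : _ - 1 = (z - w) / w); last by field.
    by rewrite mulf_neq0 ?invr_eq0.
  have -> : \sum_(k < n) (- w ^- k.+1) * z ^+ k = - w^-1 * \sum_(k < n) r ^+ k.
    rewrite mulr_sumr; apply: eq_bigr => k _.
    by rewrite /r expr_div_n exprS invfM; ring.
  have E := subrX1 r n.
  have -> : \sum_(k < n) r ^+ k = (r ^+ n - 1) / (r - 1).
    by rewrite E mulrAC divff // mul1r.
  have -> : (z - w)^-1 = w^-1 / (r - 1).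
    by rewrite -invfM /r; congr (_^-1); field.
  by field; rewrite r1.
have rN : N r <= 2^-1.
  by rewrite normcM normcV ler_pdivrMr; lra.
rewrite normcM normcV normcX ler_pdivrMr; last by lra.
apply: (@le_trans _ _ (2^-1 ^+ n)).
  by rewrite lerXn2r ?nnegrE ?normc_ge0 //; lra.
by apply: (le_trans Hn); rewrite ler_pM2l.
Qed.

End Winding.

(** * Local constancy of the winding number *)

Section Component.
Context {R : realType}.
Variable C : R -> R[i].
Local Notation N := (@normc R).
Hypothesis jC : jordan_curve C.
Hypothesis rC : rectifiable C.

Lemma winding_near w0 : ~ on_curve C w0 -> exists2 d : R, 0 < d &
  forall w, N (w - w0) <= d -> forall v, winding C w0 v <-> winding C w v.
Proof.
(* A point within d/4 of w0 keeps distance 3d/4 from the curve, and d/4 <= 3d/8, so [winding_shift]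
   applies in both directions. *)
move=> /(curve_dist jC)[d d0 Hd]; exists (d / 4) => [|w ww v]; first lra.
split; first by apply: (winding_shift jC rC d0 Hd); lra.
have d1 : 0 < d * 3 / 4 by lra.
apply: (winding_shift jC rC d1) => [z /Hd zd|]; last by rewrite normcB; lra.
have := le_normcD (z - w) (w - w0); rewrite subrKA; lra.
Qed.

(** Within the connected component of w, the points with integral 0 form a relatively open and
    closed subset by [winding_near]; it is nonempty because an unbounded component contains a point
    as in [winding_far]. *)
Lemma winding_exterior w : exterior_pt C w -> winding C w 0.
Proof.
move=> [Cw unb]; set K := component C w in unb.
have KC : K `<=` [set z : R[i]^o | ~ on_curve C z] by apply: connected_component_sub.
have Kw : K w by apply: connected_component_refl.
have [M M0 HM] := bounded_pos (proj1 (unif_cont_id jC)).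
have [w1 Kw1 Mw1] : exists2 w1, K w1 & 2 * M <= N w1.
  apply: contrapT => H; apply: unb; exists (2 * M)%:C%C; split.
    by apply/complex_realP; exists (2 * M).
  move=> x Mx z Kz; apply/ltW/le_lt_trans/Mx.
  have : (N z)%:C%C <= (2 * M)%:C%C :> R[i].
    rewrite lecR leNgt; apply/negP => /ltW h; by apply: H; exists z.
  exact.
have near z : K z -> forall v, \forall u \near (z : R[i]^o), winding C z v <-> winding C u v.
  move=> /KC /winding_near [d d0 Hd] v; apply/nbhs_normP.
  exists d%:C%C => /=; first by rewrite ltcR.
  move=> u zu; apply: Hd; have : (N (z - u))%:C%C < d%:C%C :> R[i] by [].
  by rewrite ltcR normcB => /ltW.
suff : K `&` [set z | winding C z 0] = K by move=> E; move: Kw; rewrite -E => -[].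
apply: (@component_connected (R[i]^o) [set z | ~ on_curve C z] w).
- by exists w1; split => //; apply: winding_far HM Mw1.
- exists ([set z | winding C z 0] : set R[i]^o)°; first exact: open_interior.
  apply/seteqP; split => z [Kz Wz]; split => //; last exact: interior_subset Wz.
  by apply: filterS (near z Kz 0) => u [+ _]; apply.
- exists (closure (K `&` [set z | winding C z 0])); first exact: closed_closure.
  apply/seteqP; split => z [Kz Wz]; split => //; first exact: subset_closure.
  by have [u [[_ Wu] /= /iffRL]] := Wz _ (near z Kz 0); apply.
Qed.

End Component.

(** * Rational functions odd under inversion *)

(** Semantic counterpart of [laurent R]: truncated products and substitutions are handled as
    functions off 0, without computing coefficients. *)
Definition laurent_fun {R : realType} (h : R[i] -> R[i]) : Prop :=
  exists N (p : {poly R[i]}), forall x, x != 0 -> h x = x ^- N * p.[x].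

Section RationalFunctions.
Context {R : realType}.
Variable C : R -> R[i].
Hypothesis jC : jordan_curve C.
Hypothesis rC : rectifiable C.
Hypothesis oC : counterclockwise C.
Hypothesis C0 : ~ on_curve C 0.
Hypothesis W0 : winding C 0 twopii.
Variable ka : R[i].
Hypothesis ka0 : ka != 0.
Implicit Types (F G : R[i] -> R[i]) (P Q : seq R[i]).

(* p may be a pole of a function F on C^* and ka / p a pole of F(ka / x). *)
Definition good p : Prop :=
  [/\ p != 0, interior_pt C p & exterior_pt C (ka / p)].

(** All [good] points are removed at once. What remains contains the curve and is stable under x ->
    ka / x, so identities of rational functions need checking only there. *)
Definition off_poles x : Prop :=
  x != 0 /\ forall p, good p -> x != p /\ ka / x != p.

(** The invariance of the integral of F(x) dx/x under x -> ka/x, phrased with a single integral so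
    that neither side has to be evaluated. *)
Definition even_int F : Prop := is_cint C (fun x => (F x - F (ka / x)) / x) 0.

Lemma kaK x : x != 0 -> ka / (ka / x) = x.
Proof. by move=> x0; rewrite invf_div mulrCA divff // mulr1. Qed.

Lemma off_polesV x : off_poles x -> off_poles (ka / x).
Proof.
move=> [x0 H]; split; first by rewrite mulf_neq0 ?invr_eq0.
by move=> p /H[? ?]; rewrite kaK.
Qed.

Lemma curve_off_poles x : on_curve C x -> off_poles x.
Proof.
move=> Cx; have x0 : x != 0 by apply/eqP => E; apply: C0; rewrite -E.
split => // p [p0 [ip _] [ep _]].
split; first by apply/eqP => E; apply: ip; rewrite -E.
by apply/eqP => E; apply: ep; rewrite -E kaK.
Qed.

Lemma even_int_ext F G : (forall x, off_poles x -> F x = G x) ->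
  even_int F -> even_int G.
Proof.
move=> FG; apply: cint_ext => x /curve_off_poles Dx.
by rewrite !FG //; apply: off_polesV.
Qed.

Lemma even_intD F G : even_int F -> even_int G -> even_int (fun x => F x + G x).
Proof.
move=> HF HG; have := cintD HF HG; rewrite addr0.
by apply: cint_ext => x _; ring.
Qed.

Lemma even_intZ a F : even_int F -> even_int (fun x => a * F x).
Proof.
move=> HF; have := cintZ a HF; rewrite mulr0.
by apply: cint_ext => x _; ring.
Qed.

Lemma even_intV F : even_int F -> even_int (fun x => F (ka / x)).
Proof.
move=> HF; have := cintZ (-1) HF; rewrite mulr0.
apply: cint_ext => x /curve_off_poles[x0 _].
by rewrite kaK //; ring.
Qed.

Lemma even_int_cst a : even_int (fun=> a).
Proof. by apply: cint_ext (cint0 C) => x _; rewrite subrr mul0r. Qed.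

Lemma even_int_sum n (F : nat -> R[i] -> R[i]) :
  (forall k, even_int (F k)) -> even_int (fun x => \sum_(k < n) F k x).
Proof.
move=> H; elim: n => [|n IH].
  by apply: even_int_ext (even_int_cst 0) => x _; rewrite big_ord0.
apply: even_int_ext (even_intD IH (H n)) => x _.
by rewrite big_ord_recr.
Qed.

(** The integrand is 1/(x - p) - 1/x + 1/(x - ka/p). The first two contributions are equal and
    cancel, as p is inside and 0 has the same winding number; the third vanishes, as ka/p is
    outside. *)
Lemma even_int_pole1 p : good p -> even_int (fun x => (1 - p / x)^-1).
Proof.
move=> gp; have [p0 ip ep] := gp.
have H1 : winding C p twopii by apply: oC.
have H3 := winding_exterior jC rC ep.
have := cintB H1 (cintB W0 H3); rewrite subr0 subrr.
apply: cint_ext => x Cx; have [x0 H] := curve_off_poles Cx.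
have [h1 h2] := H _ gp.
have n1 : x - p != 0 by rewrite subr_eq0.
have n2 : ka - p * x != 0.
  rewrite subr_eq0; apply: contra h2 => /eqP ->.
  by apply/eqP; field.
have n3 : x * p - ka != 0 by rewrite -opprB oppr_eq0 mulrC.
by rewrite subr0; field; rewrite x0 ka0 p0 n1 n2.
Qed.

(** With u = (1 - p/x)^-1, raising the exponent from m+1 to m+2 changes u^(m+1)/x by p u^m / (x -
    p)^2. This, like its analogue for u(ka/x), is of the form treated in [cint_moebius]. *)
Lemma even_int_pole p m : good p -> even_int (fun x => (1 - p / x) ^- m).
Proof.
move=> gp; elim: m => [|[|m] IH].
- by apply: even_int_ext (even_int_cst 1) => x _; rewrite expr0 invr1.
- by apply: even_int_ext (even_int_pole1 gp) => x _; rewrite expr1.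
have [p0 ip ep] := gp.
have D1 : 1 * (- p) - 0 * 1 != 0 :> R[i] by rewrite mul0r mul1r subr0 oppr_eq0.
have D2 : 0 * 1 - 1 * (- (p / ka)) != 0 :> R[i].
  by rewrite mul0r mul1r sub0r opprK mulf_neq0 ?invr_eq0.
have nz x : on_curve C x -> [/\ x != 0, x - p != 0 & ka - p * x != 0].
  move=> /curve_off_poles[x0 /(_ _ gp) [h1 h2]]; split; rewrite // subr_eq0 //.
  by apply: contra h2 => /eqP ->; apply/eqP; field.
have N1 z : on_curve C z -> 1 * z + - p != 0.
  by move=> /nz[_ h _]; rewrite mul1r.
have N2 z : on_curve C z -> - (p / ka) * z + 1 != 0.
  move=> /nz[_ _ h]; rewrite (_ : _ + 1 = (ka - p * z) / ka); last by field.
  by rewrite mulf_neq0 ?invr_eq0.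
have := cintD IH (cintB (cintZ p (cint_moebius jC rC m D1 N1))
                  (cintZ (p / ka) (cint_moebius jC rC m D2 N2))).
rewrite !mulr0 subrr addr0; apply: cint_ext => x /nz[x0 n1 n2].
have -> : (1 - p / x) = (x - p) / x by field.
have -> : (1 - p / (ka / x)) = (ka - p * x) / ka by field; rewrite x0 ka0.
have -> : (1 * x + 0) / (1 * x - p) = x / (x - p) by rewrite mul1r addr0.
have -> : (0 * x + 1) / (- (p / ka) * x + 1) = ka / (ka - p * x).
  by field; rewrite ka0 n2.
have -> : - (p / ka) * x + 1 = (ka - p * x) / ka by field.
rewrite -!exprVn !invf_div !exprS.
move: ((x / (x - p)) ^+ m) ((ka / (ka - p * x)) ^+ m) => A B.
by field; rewrite x0 ka0 n1 n2.
Qed.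

Definition poles P x : R[i] := \prod_(p <- P) (1 - p / x)^-1.

(** Partial fractions, poles being allowed to coincide. If all are equal, [poles P] is a pure power.
    Otherwise two distinct factors are separated by (p - p') / ((1 - p/x)(1 - p'/x)) = p / (1 - p/x)
    - p' / (1 - p'/x), which shortens the list by one. *)
Lemma even_int_poles P : (forall p, p \in P -> good p) -> even_int (poles P).
Proof.
have [n] := ubnP (size P); elim: n P => // n IH [|p P] /=; rewrite ?ltnS => sP gP.
  by apply: even_int_ext (even_int_cst 1) => x _; rewrite /poles big_nil.
have gp : good p by apply: gP; rewrite mem_head.
have [/allP eP|/allPn[p' p'P pp']] := boolP (all (pred1 p) P).
  apply: even_int_ext (even_int_pole (size (p :: P)) gp) => x _.
  rewrite /poles big_cons (eq_big_seq (fun=> (1 - p / x)^-1)) => [|q /eP/eqP -> //].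
  by rewrite big_const_seq count_predT iter_mulr_1 -exprVn exprS.
have gp' : good p' by apply: gP; rewrite inE p'P orbT.
have E x : poles P x = (1 - p' / x)^-1 * poles (rem p' P) x.
  by rewrite /poles (perm_big _ (perm_to_rem p'P)) big_cons.
have sz : (size (rem p' P)).+1 = size P.
  by rewrite size_rem // prednK //; case: (P) p'P.
have g1 : forall q, q \in p :: rem p' P -> good q.
  by move=> q; rewrite inE => /orP[/eqP -> //|/mem_rem h]; apply: gP; rewrite inE h orbT.
have g2 : forall q, q \in p' :: rem p' P -> good q.
  by move=> q; rewrite inE => /orP[/eqP -> //|/mem_rem h]; apply: gP; rewrite inE h orbT.
have := even_intD (even_intZ (p / (p - p')) (IH (p :: rem p' P) _ g1))
   (even_intZ (- p' / (p - p')) (IH (p' :: rem p' P) _ g2)).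
rewrite /= sz => /(_ sP sP); apply: even_int_ext => x [x0 Hx].
have [[h1 _] [h2 _]] := (Hx _ gp, Hx _ gp').
have n1 : x - p != 0 by rewrite subr_eq0.
have n2 : x - p' != 0 by rewrite subr_eq0.
have n3 : p - p' != 0 by rewrite subr_eq0 eq_sym.
rewrite /poles !big_cons -!/(poles _ _) E.
by field; rewrite x0 n1 n2 n3.
Qed.

(** For n > 0 both x^n / x and x^-n / x have a primitive off 0; negative n are images under x ->
    ka/x. *)
Lemma even_int_exprz (n : int) : even_int (fun x => x ^ n).
Proof.
have H k : even_int (fun x => x ^+ k.+1).
  have := cintB (cint_expr jC rC k) (cintZ (ka ^+ k.+1) (cint_exprV jC rC k C0)).
  rewrite mulr0 subr0; apply: cint_ext => x /curve_off_poles[x0 _].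
  rewrite subr0 expr_div_n (exprS x k) (exprS x k.+1) (exprS x k).
  by field; rewrite x0 expf_neq0.
case: n => [[|k]|k].
- by apply: even_int_ext (even_int_cst 1) => x _.
- exact: H.
have := even_intZ (ka ^- k.+1) (even_intV (H k)); apply: even_int_ext => x [x0 _].
rewrite expr_div_n mulrA mulVf ?expf_neq0 // mul1r //.
Qed.

(** The relation [E], which expands (1 - p/x) times the product, moves the exponent by one at the
    cost of a term with fewer poles; it is used upwards and downwards from n = 0. *)
Lemma even_int_laurent_poles P (n : int) : (forall p, p \in P -> good p) ->
  even_int (fun x => x ^ n * poles P x).
Proof.
elim: P n => [|p P IH] n gP.
  by apply: even_int_ext (even_int_exprz n) => x _; rewrite /poles big_nil mulr1.
have gp : good p by apply: gP; rewrite mem_head.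
have {}IH k : even_int (fun x => x ^ k * poles P x).
  by apply: IH => q qP; apply: gP; rewrite inE qP orbT.
have [p0 _ _] := gp.
have E x k : off_poles x ->
    x ^ (k + 1) * poles (p :: P) x = x ^ (k + 1) * poles P x + p * (x ^ k * poles (p :: P) x).
  move=> [x0 /(_ _ gp)[h1 _]]; have n1 : x - p != 0 by rewrite subr_eq0.
  by rewrite /poles big_cons expfzDr // expr1z; field; rewrite x0 n1.
elim/int_ind: n => [|n Hn|n Hn].
- by apply: even_int_ext (even_int_poles gP) => x _; rewrite expr0z mul1r.
- have := even_intD (IH (n%:Z + 1)) (even_intZ p Hn).
  by apply: even_int_ext => x Dx; rewrite -E // -PoszD addn1.
have := even_intZ p^-1 (even_intD Hn (even_intZ (-1) (IH (- n%:Z)))).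
apply: even_int_ext => x Dx; have := E x (- n.+1%:Z) Dx.
have -> : - n.+1%:Z + 1 = - n%:Z by rewrite -addn1 PoszD opprD addrK.
by move=> ->; field.
Qed.

(** Poles inside and outside are separated one pair at a time: for u = (1 - p/x)^-1 and v = (1 - q
    x/ka)^-1, u v = ka / (ka - p q) (u + v - 1). *)
Lemma even_int_poles2 P Q (n : int) : (forall p, p \in P -> good p) ->
  (forall p, p \in Q -> good p) ->
  even_int (fun x => x ^ n * (poles P x * poles Q (ka / x))).
Proof.
move=> + gQ; elim: Q gQ P => [_ P gP|q Q IHQ gQ].
  apply: even_int_ext (even_int_laurent_poles n gP) => x _.
  by rewrite [poles [::] _]big_nil mulr1.
have gq : good q by apply: gQ; rewrite mem_head.
have {}IHQ P : (forall p, p \in P -> good p) ->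
    even_int (fun x => x ^ n * (poles P x * poles Q (ka / x))).
  by apply: IHQ => p pQ; apply: gQ; rewrite inE pQ orbT.
elim=> [_|p P IHP gP].
  (* Without inside poles, the function is the image under x -> ka/x of one with inside poles
     only. *)
  have := even_intZ (ka ^ n) (even_intV (even_int_laurent_poles (- n) gQ)).
  apply: even_int_ext => x [x0 _].
  rewrite [poles [::] _]big_nil mul1r expfzMl exprz_inv opprK -invr_expz.
  by field; rewrite expfz_neq0.
have gp : good p by apply: gP; rewrite mem_head.
have gP' r : r \in P -> good r by move=> rP; apply: gP; rewrite inE rP orbT.
have [p0 ip ep] := gp; have [q0 iq eq] := gq.
(* Otherwise q = ka / p would be both interior and exterior. *)
have pq : ka - p * q != 0.
  rewrite subr_eq0; apply/eqP => E; case: iq => _ bq; case: ep => _; apply.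
  by rewrite E [p * q]mulrC mulfK.
have := even_intZ (ka / (ka - p * q)) (even_intD (IHQ _ gP)
  (even_intD (IHP gP') (even_intZ (-1) (IHQ _ gP')))).
apply: even_int_ext => x [x0 Hx].
have [[h1 _] [_ h2]] := (Hx _ gp, Hx _ gq).
have n1 : x - p != 0 by rewrite subr_eq0.
have n2 : ka - q * x != 0.
  by rewrite subr_eq0; apply: contra h2 => /eqP ->; apply/eqP; field.
rewrite /poles !big_cons -!/(poles _ _).
by field; rewrite x0 ka0 n1 n2 pq.
Qed.

(** For an odd F, F(x) - F(ka/x) is 2 F(x), so the invariance of the integral makes it vanish. *)
Lemma cint_odd h P : laurent_fun h -> (forall p, p \in P -> good p) ->
  (forall x, x != 0 -> h (ka / x) = - h x) ->
  is_cint C (fun x => h x * (poles P x * poles P (ka / x)) / x) 0.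
Proof.
move=> [N [p hE]] gP hodd.
have H : even_int (fun x => \sum_(i < size p)
    p`_i * (x ^ (i%:Z - N%:Z) * (poles P x * poles P (ka / x)))).
  apply: (@even_int_sum (size p) (fun i x => p`_i * (x ^ (i%:Z - N%:Z) *
    (poles P x * poles P (ka / x))))) => k.
  exact/even_intZ/even_int_poles2.
have {}H : even_int (fun x => h x * (poles P x * poles P (ka / x))).
  apply: even_int_ext H => x [x0 _].
  rewrite hE // horner_coef mulr_sumr mulr_suml; apply: eq_bigr => i _.
  by rewrite expfzDr // -invr_expz -!exprnP; ring.
have := cintZ 2^-1 H; rewrite mulr0; apply: cint_ext => x /curve_off_poles[x0 _].
rewrite hodd // kaK //.
by field.
Qed.

End RationalFunctions.

(** * Infinite products *)

Section QPochhammer.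
Context {R : realType}.
Local Notation N := (@normc R).
Variable q : R[i].
Hypothesis q1 : N q < 1.

Definition qpochn n y : R[i] := \prod_(0 <= j < n) (1 - y * q ^+ j).

(** The constant K such that the n-th truncation of (y; q)_oo is within K |q|^n of the limit for |y|
    <= M. The exponential bounds all partial products, the other factor sums the geometric tail. *)
Definition qpoch_rate (M : R) : R := expR (M / (1 - N q)) * (M / (1 - N q)).

Lemma qpoch_rate_ge0 M : 0 <= M -> 0 <= qpoch_rate M.
Proof. by move=> M0; rewrite mulr_ge0 ?expR_ge0 // divr_ge0 // subr_ge0 ltW. Qed.

Lemma qpochnS n y : qpochn n.+1 y = qpochn n y * (1 - y * q ^+ n).
Proof. by rewrite /qpochn big_nat_recr. Qed.

Lemma qpochnD n k y : qpochn (n + k) y = qpochn n y * qpochn k (y * q ^+ n).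
Proof.
elim: k => [|k IH]; first by rewrite addn0 [qpochn 0 _]big_geq // mulr1.
by rewrite addnS !qpochnS IH -mulrA -(mulrA y) -exprD.
Qed.

Lemma sum_expr_le n : \sum_(0 <= j < n) N q ^+ j <= (1 - N q)^-1.
Proof.
have q0 := normc_ge0 q; have h : 1 - N q != 0 by rewrite gt_eqF // subr_gt0.
suff -> : \sum_(0 <= j < n) N q ^+ j = (1 - N q ^+ n) / (1 - N q).
  rewrite ler_piMl ?invr_ge0; last 2 first.
  - by rewrite subr_ge0 ltW.
  - by rewrite lerBlDr lerDl exprn_ge0.
  by [].
elim: n => [|n IH]; first by rewrite big_geq // expr0 subrr mul0r.
by rewrite big_nat_recr //= IH exprS; field.
Qed.

Lemma qpochn_bound M n y : N y <= M -> N (qpochn n y) <= expR (M / (1 - N q)).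
Proof.
move=> yM; have M0 : 0 <= M by apply: le_trans yM; exact: normc_ge0.
apply: (@le_trans _ _ (expR (\sum_(0 <= j < n) M * N q ^+ j))); last first.
  by rewrite ler_expR -mulr_sumr ler_wpM2l // sum_expr_le.
elim: n => [|n IH].
  by rewrite [qpochn 0 _]big_geq // big_geq // norm1c expR0.
rewrite qpochnS big_nat_recr //= expRD normcM.
apply: ler_pM; rewrite ?normc_ge0 //.
apply: le_trans (expR_ge1Dx _); apply: (le_trans (le_normcD _ _)).
by rewrite norm1c lerD2l normcN normcM normcX ler_wpM2r // exprn_ge0 // normc_ge0.
Qed.

Lemma qpochn_cauchy M n k y : N y <= M ->
  N (qpochn (n + k) y - qpochn n y) <= qpoch_rate M * N q ^+ n.
Proof.
move=> yM; have M0 : 0 <= M by apply: le_trans yM; exact: normc_ge0.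
apply: (@le_trans _ _ (\sum_(0 <= j < k) expR (M / (1 - N q)) * M * N q ^+ n * N q ^+ j)).
  elim: k => [|k IH]; first by rewrite addn0 subrr norm0c big_geq.
  rewrite addnS qpochnS big_nat_recr //=.
  have -> : qpochn (n + k) y * (1 - y * q ^+ (n + k)) - qpochn n y =
    (qpochn (n + k) y - qpochn n y) - qpochn (n + k) y * (y * q ^+ (n + k)) by ring.
  apply: (le_trans (le_normcD _ _)); apply: lerD => //.
  rewrite normcN !normcM normcX exprD -!mulrA ler_pM ?normc_ge0 //.
  - by rewrite mulr_ge0 ?normc_ge0 // mulr_ge0 // exprn_ge0 // normc_ge0.
  - exact: qpochn_bound.
  - by rewrite ler_wpM2r // mulr_ge0 // exprn_ge0 // normc_ge0.
rewrite -mulr_sumr.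
have -> : qpoch_rate M * N q ^+ n = expR (M / (1 - N q)) * M * N q ^+ n * (1 - N q)^-1.
  by rewrite /qpoch_rate; ring.
rewrite ler_wpM2l ?sum_expr_le // mulr_ge0 ?mulr_ge0 ?expR_ge0 //.
by rewrite exprn_ge0 // normc_ge0.
Qed.

Lemma expr_small (K e : R) : 0 < e -> exists n, K * N q ^+ n <= e.
Proof.
move=> e0; have q0 := normc_ge0 q.
have K0 : 0 < `|K| + 1 by have := normr_ge0 K; lra.
have e1 : 0 < e / (`|K| + 1) by rewrite divr_gt0.
have := @cvg_expr R (N q); rewrite ger0_norm //.
move=> /(_ q1) /cvgrPdist_le /(_ _ e1) [n _ /(_ n (leqnn n))].
rewrite sub0r normrN ger0_norm ?exprn_ge0 // ler_pdivlMr // => h; exists n.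
apply: le_trans h; rewrite mulrC ler_wpM2l ?exprn_ge0 //.
by have := ler_norm K; lra.
Qed.

Lemma geometric_cauchy_cvg (K : R) (a : nat -> R) :
  (forall n k, `|a (n + k)%N - a n| <= K * N q ^+ n) -> cvgn a.
Proof.
move=> H; apply: cauchy_cvg; apply: cauchy_exP => e e0.
have e2 : 0 < e / 2 by lra.
have [n Hn] := expr_small K e2; exists (a n); exists n => // m /= nm.
rewrite /ball /= distrC -(subnKC nm).
by apply: (le_lt_trans (H _ _)); lra.
Qed.

(** The Cauchy estimate is passed to real and imaginary parts, where completeness of R gives the
    limit [l]; this is then identified with the limit defining [qpoch1]. *)
Lemma qpoch1_lim M n y : N y <= M ->
  N (qpoch1 q y - qpochn n y) <= qpoch_rate M * N q ^+ n.
Proof.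
move=> yM; pose u k := qpochn k y.
have ReB (z w : R[i]) : complex.Re (z - w) = complex.Re z - complex.Re w.
  by case: z w => ? ? [].
have ImB (z w : R[i]) : complex.Im (z - w) = complex.Im z - complex.Im w.
  by case: z w => ? ? [].
have hRe z : `|complex.Re z| <= N z.
  by rewrite -lecR; apply: (@normc_ge_Re R z).
have hN z : N z <= `|complex.Re z| + `|complex.Im z|.
  have {1}-> : z = (complex.Re z)%:C%C + 'i%C * (complex.Im z)%:C%C by exact: complexE.
  apply: (le_trans (le_normcD _ _)); rewrite normcM.
  have h x : N (x%:C%C) = `|x| by rewrite /normc /= expr0n addr0 sqrtr_sqr.
  by rewrite !h /normc /= expr0n add0r expr1n sqrtr1 mul1r.
have hIm z : `|complex.Im z| <= N z.
  have -> : complex.Im z = - complex.Re (z * 'i%C) by rewrite ReiNIm opprK.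
  rewrite normrN; apply: (le_trans (hRe _)).
  by rewrite normcM [N 'i%C]/normc /= expr0n add0r expr1n sqrtr1 mulr1.
have [cR cI] : cvgn (fun k => complex.Re (u k)) /\ cvgn (fun k => complex.Im (u k)).
  split; apply: (@geometric_cauchy_cvg (qpoch_rate M)) => m k.
    by rewrite -ReB; apply: le_trans (qpochn_cauchy m k yM).
  by rewrite -ImB; apply: le_trans (qpochn_cauchy m k yM).
pose l : R[i] := (limn (fun k => complex.Re (u k)) +i* limn (fun k => complex.Im (u k)))%C.
have ul e : 0 < e -> \forall k \near \oo, N (l - u k) <= e.
  move=> e0; have e2 : 0 < e / 2 by lra.
  move/cvgrPdist_le: cR => /(_ _ e2) h1; move/cvgrPdist_le: cI => /(_ _ e2) h2.
  near=> k; apply: (le_trans (hN _)).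
  have h3 : `|complex.Re (l - u k)| <= e / 2 by rewrite ReB; near: k; exact: h1.
  have h4 : `|complex.Im (l - u k)| <= e / 2 by rewrite ImB; near: k; exact: h2.
  lra.
have -> : qpoch1 q y = l.
  apply: (@cvg_lim (R[i]^o)); first exact: norm_hausdorff.
  apply/cvgrPdist_le => e e0.
  have Ee : e = (complex.Re e)%:C%C by rewrite RRe_real // gtr0_real.
  have e0' : 0 < complex.Re e by rewrite -ltcR -Ee.
  near=> k.
  have : (N (l - u k))%:C%C <= e by rewrite Ee lecR; near: k; exact: ul.
  exact.
apply/ler_addgt0Pr => e e0.
have [k0 _ /(_ (n + k0)%N (leq_addl _ _)) /= h] := ul _ e0.
have := le_normcD (l - u (n + k0)%N) (u (n + k0)%N - u n); rewrite subrKA.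
have := qpochn_cauchy n k0 yM; rewrite -/(u _) -/(u _).
lra.
Unshelve. all: by end_near.
Qed.

Lemma qpoch1_shift n y : qpoch1 q y = qpochn n y * qpoch1 q (y * q ^+ n).
Proof.
apply/eqP; rewrite -subr_eq0 -normc_eq0 eq_le normc_ge0 andbT.
apply/ler_addgt0Pr => e e0; rewrite add0r.
set B := N (qpochn n y); pose M' := N (y * q ^+ n).
pose K := qpoch_rate (N y) * N q ^+ n + B * qpoch_rate M'.
have [k Hk] := expr_small K e0; apply: le_trans Hk.
have h1 := qpoch1_lim (n + k) (lexx (N y)).
have h2 := qpoch1_lim k (lexx M').
rewrite -(subrKA (qpochn (n + k) y)); apply: (le_trans (le_normcD _ _)).
rewrite {2}qpochnD -mulrBr normcM normcB in h2 *.
have := ler_wpM2l (normc_ge0 (qpochn n y)) h2; rewrite -/B => h3.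
by move: h1 h3; rewrite exprD /K normcB; lra.
Qed.

Lemma qpoch1S y : qpoch1 q y = (1 - y) * qpoch1 q (q * y).
Proof.
rewrite (qpoch1_shift 1) qpochnS [qpochn 0 _]big_geq // mul1r expr0 expr1 mulr1.
by rewrite mulrC [y * q]mulrC mulrC.
Qed.

Lemma qpoch1_eq0 y n : y * q ^+ n = 1 -> qpoch1 q y = 0.
Proof. by move=> E; rewrite (qpoch1_shift n.+1) qpochnS E subrr mulr0 mul0r. Qed.

(** The bound (1 - |q|)/4 makes the rate equal to e^(1/4)/4, at most 1/3 since 1 - 1/4 <=
    e^(-1/4). *)
Lemma qpoch1_near1 y : N y <= (1 - N q) / 4 -> 1 / 2 <= N (qpoch1 q y).
Proof.
move=> h; have := qpoch1_lim 0 h; rewrite [qpochn 0 _]big_geq // expr0 mulr1.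
have -> : qpoch_rate ((1 - N q) / 4) = expR (1 / 4) / 4.
  have h' : 1 - N q != 0 by rewrite gt_eqF // subr_gt0.
  have E : (1 - N q) / 4 / (1 - N q) = 1 / 4 by field.
  by rewrite /qpoch_rate E; lra.
have h1 : expR (1 / 4) <= 4 / 3 :> R.
  have := expR_ge1Dx (- (1 / 4) : R); rewrite expRN => h1.
  have e0 := expR_gt0 (1 / 4 : R).
  have : (1 + - (1 / 4)) * expR (1 / 4) <= (expR (1 / 4))^-1 * expR (1 / 4) :> R.
    by rewrite ler_pM2r.
  by rewrite mulVf ?gt_eqF //; lra.
have := ler_normcB 1 (1 - qpoch1 q y).
rewrite opprB addrCA subrr addr0 norm1c (normcB 1); lra.
Qed.

End QPochhammer.

Section LaurentFunctions.
Context {R : realType}.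
Implicit Types (g h : R[i] -> R[i]).

Lemma laurent_fun_cst c : laurent_fun (fun=> c : R[i]).
Proof. by exists 0, c%:P => x _; rewrite hornerC expr0 invr1 mul1r. Qed.

Lemma laurent_fun_id : laurent_fun (fun x : R[i] => x).
Proof. by exists 0, 'X => x _; rewrite hornerX expr0 invr1 mul1r. Qed.

Lemma laurent_fun_inv : laurent_fun (fun x : R[i] => x^-1).
Proof. by exists 1, 1 => x _; rewrite hornerE expr1 mulr1. Qed.

Lemma laurent_funD g h : laurent_fun g -> laurent_fun h ->
  laurent_fun (fun x => g x + h x).
Proof.
move=> [N [p gE]] [M [r hE]]; exists (N + M), (p * 'X^M + r * 'X^N) => x x0.
rewrite gE // hE // hornerD !hornerM !hornerXn exprD.
by field; rewrite !expf_neq0.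
Qed.

Lemma laurent_funM g h : laurent_fun g -> laurent_fun h ->
  laurent_fun (fun x => g x * h x).
Proof.
move=> [N [p gE]] [M [r hE]]; exists (N + M), (p * r) => x x0.
rewrite gE // hE // hornerM exprD.
by field; rewrite !expf_neq0.
Qed.

Lemma laurent_funX g n : laurent_fun g -> laurent_fun (fun x => g x ^+ n).
Proof.
move=> Hg; elim: n => [|n IH].
  by have := laurent_fun_cst 1; congr laurent_fun; apply/funext => x; rewrite expr0.
by have := laurent_funM Hg IH; congr laurent_fun; apply/funext => x; rewrite exprS.
Qed.

Lemma laurent_fun_scale g c : c != 0 -> laurent_fun g -> laurent_fun (fun x => g (c * x)).
Proof.
move=> c0 [N [p gE]]; exists N, (c ^- N *: (p \Po (c *: 'X))) => x x0.
rewrite gE ?mulf_neq0 // hornerZ horner_comp hornerZ hornerX exprMn.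
by field; rewrite !expf_neq0.
Qed.

Lemma laurent_fun_qpochn q n g : laurent_fun g ->
  laurent_fun (fun x => qpochn q n (g x)).
Proof.
move=> Hg; elim: n => [|n IH].
  have := laurent_fun_cst 1; congr laurent_fun; apply/funext => x.
  by rewrite /qpochn big_geq.
have Hq : laurent_fun (fun x => 1 + (- q ^+ n) * g x).
  apply: laurent_funD; first exact: laurent_fun_cst.
  by apply: laurent_funM => //; exact: laurent_fun_cst.
have := laurent_funM IH Hq; congr laurent_fun; apply/funext => x.
by rewrite qpochnS; congr (_ * (1 + _)); rewrite mulNr mulrC.
Qed.

End LaurentFunctions.

(** * Uniform limits of truncated products on the contour *)

Section UniformLimits.
Context {R : realType}.
Local Notation N := (@normc R).
Variable C : R -> R[i].
Hypothesis jC : jordan_curve C.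
Hypothesis rC : rectifiable C.
Hypothesis C0 : ~ on_curve C 0.
Variable q : R[i].
Hypothesis q1 : N q < 1.
Implicit Types (f g h : R[i] -> R[i]).

Lemma laurent_unif_cont h : laurent_fun h ->
  exists2 g, unif_cont C g & forall z, on_curve C z -> h z = g z.
Proof.
move=> [M [p hE]].
have z0 z : on_curve C z -> z != 0.
  by move=> Cz; apply/eqP => E; apply: C0; rewrite -E.
have [d d0 Hd] := curve_min (unif_contX M (unif_cont_id jC)) (fun z Cz => expf_neq0 M (z0 z Cz)).
exists (fun z => z ^- M * p.[z]); last by move=> z /z0; apply: hE.
apply: unif_contM; first exact: unif_contV d0 Hd (unif_contX M (unif_cont_id jC)).
suff : unif_cont C (fun z => \sum_(i < size p) p`_i * z ^+ i).
  by congr unif_cont; apply/funext => z; rewrite horner_coef.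
elim: (size p) => [|n IH].
  have := unif_cont_cst C 0; congr unif_cont.
  by apply/funext => z; rewrite big_ord0.
have := unif_contD IH (unif_contM (unif_cont_cst C p`_n) (unif_contX n (unif_cont_id jC))).
by congr unif_cont; apply/funext => z; rewrite big_ord_recr.
Qed.

Definition unif_lim (G : nat -> R[i] -> R[i]) g : Prop :=
  (exists B, forall z, on_curve C z -> N (g z) <= B) /\
  forall e : R, 0 < e -> exists n0, forall n, (n0 <= n)%N ->
    forall z, on_curve C z -> N (G n z - g z) <= e.

Lemma unif_lim_laurent h : laurent_fun h -> unif_lim (fun=> h) h.
Proof.
move=> /laurent_unif_cont[g [[B HB] _] hg]; split.
  by exists B => z Cz; rewrite hg // HB.
by move=> e e0; exists 0%N => n _ z _; rewrite subrr norm0c ltW.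
Qed.

Lemma unif_limM G H g h : unif_lim G g -> unif_lim H h ->
  unif_lim (fun n z => G n z * H n z) (fun z => g z * h z).
Proof.
move=> [/bounded_pos[A A0 HA] Gg] [/bounded_pos[B B0 HB] Hh]; split.
  exists (A * B) => z Cz; rewrite normcM.
  by apply: ler_pM; rewrite ?normc_ge0 ?HA ?HB.
move=> e e0; have eA : 0 < e / (A + A) by rewrite divr_gt0; lra.
have eB : 0 < e / (2 * (B + 1)) by rewrite divr_gt0; lra.
have [n1 H1] := Gg _ eB; have [n2 H2] := Hh _ eA; have [n3 H3] := Hh _ ltr01.
exists (maxn n1 (maxn n2 n3)) => n; rewrite !geq_max => /and3P[k1 k2 k3] z Cz.
have -> : G n z * H n z - g z * h z =
  (G n z - g z) * H n z + g z * (H n z - h z) by ring.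
apply: (le_trans (le_normcD _ _)); rewrite !normcM.
have h1 : N (G n z - g z) * N (H n z) <= e / (2 * (B + 1)) * (B + 1).
  apply: ler_pM; rewrite ?normc_ge0 ?H1 //.
  have := H3 _ k3 _ Cz; have := ler_normcB (H n z) (h z); have := HB _ Cz; lra.
have h2 : N (g z) * N (H n z - h z) <= A * (e / (A + A)).
  by apply: ler_pM; rewrite ?normc_ge0 ?HA ?H2.
have : e / (2 * (B + 1)) * (B + 1) = e / 2 by field; lra.
have : A * (e / (A + A)) = e / 2 by field; lra.
lra.
Qed.

Lemma unif_limV G g (d : R) : 0 < d -> (forall z, on_curve C z -> d <= N (g z)) ->
  unif_lim G g -> unif_lim (fun n z => (G n z)^-1) (fun z => (g z)^-1).
Proof.
move=> d0 Hd [_ Gg]; split.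
  exists d^-1 => z Cz; rewrite normcV lef_pV2 ?posrE ?Hd //.
  by apply: lt_le_trans (Hd _ Cz).
move=> e e0; have d2 : 0 < d / 2 by lra.
have e1 : 0 < e * (d / 2 * d) by rewrite !mulr_gt0.
have [n1 H1] := Gg _ e1; have [n2 H2] := Gg _ d2.
exists (maxn n1 n2) => n; rewrite geq_max => /andP[k1 k2] z Cz.
have h1 := H1 _ k1 _ Cz; have h2 := H2 _ k2 _ Cz; have h3 := Hd _ Cz.
have h4 : d / 2 <= N (G n z).
  by have := ler_normcB (g z) (g z - G n z); rewrite subKr normcB; lra.
have n0 : g z != 0 by rewrite -normc_gt0; lra.
have m0 : G n z != 0 by rewrite -normc_gt0; lra.
have -> : (G n z)^-1 - (g z)^-1 = (g z - G n z) / (G n z * g z).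
  by field; rewrite n0 m0.
have dd : d / 2 * d <= N (G n z) * N (g z) by apply: ler_pM; lra.
rewrite normcM normcV normcM ler_pdivrMr; last first.
  by apply: lt_le_trans dd; rewrite mulr_gt0.
rewrite normcB; apply: (le_trans h1).
by rewrite ler_pM2l.
Qed.

Lemma unif_lim_qpoch f : laurent_fun f ->
  unif_lim (fun n z => qpochn q n (f z)) (fun z => qpoch1 q (f z)).
Proof.
move=> /laurent_unif_cont[g [/bounded_pos[M M0 HM] _] fg]; split.
  exists (qpoch_rate q M + 1) => z Cz.
  have := @qpoch1_lim _ q q1 M 0 (f z); rewrite fg // => /(_ (HM _ Cz)).
  rewrite [qpochn _ 0 _]big_geq // expr0 mulr1.
  have := ler_normcB (qpoch1 q (g z)) 1; rewrite norm1c; lra.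
move=> e e0; have [n0 Hn0] := expr_small q1 (qpoch_rate q M) e0.
exists n0 => n nn z Cz; rewrite fg // normcB.
apply: (le_trans (qpoch1_lim q1 n (HM _ Cz))); apply: le_trans Hn0.
rewrite ler_wpM2l ?qpoch_rate_ge0 ?(ltW M0) //.
by rewrite ler_wiXn2l ?normc_ge0 // ltW.
Qed.

(** Split off n factors, with n so large that the remaining infinite product is at least 1/2 in
    modulus. The finite product is continuous without zeros on the compact curve. *)
Lemma qpoch_min f : laurent_fun f ->
  (forall z j, on_curve C z -> f z * q ^+ j != 1) ->
  exists2 d : R, 0 < d & forall z, on_curve C z -> d <= N (qpoch1 q (f z)).
Proof.
move=> Lf nz; have [g [/bounded_pos[M M0 HM] _] fg] := laurent_unif_cont Lf.
have e0 : 0 < (1 - N q) / 4 by rewrite divr_gt0 // subr_gt0.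
have [n Hn] := expr_small q1 M e0.
have [h Uh fh] := laurent_unif_cont (laurent_fun_qpochn q n Lf).
have [|d d0 Hd] := curve_min Uh.
  move=> z Cz; rewrite -fh // /qpochn prodf_seq_neq0; apply/allP => j _ /=.
  by rewrite subr_eq0 eq_sym nz.
exists (d / 2) => [|z Cz]; first lra.
rewrite (qpoch1_shift q1 n) normcM; have := Hd _ Cz; rewrite -fh // => h1.
have h2 : 1 / 2 <= N (qpoch1 q (f z * q ^+ n)).
  apply: qpoch1_near1 => //; apply: le_trans Hn.
  rewrite normcM normcX ler_wpM2r ?exprn_ge0 ?normc_ge0 // fg //.
  exact: HM.
have := ler_pM (ltW d0) (_ : 0 <= 1 / 2) h1 h2; lra.
Qed.

Lemma unif_lim_qpochV f : laurent_fun f ->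
  (forall z j, on_curve C z -> f z * q ^+ j != 1) ->
  unif_lim (fun n z => (qpochn q n (f z))^-1) (fun z => (qpoch1 q (f z))^-1).
Proof.
move=> Lf nz; have [d d0 Hd] := qpoch_min Lf nz.
exact: unif_limV d0 Hd (unif_lim_qpoch Lf).
Qed.

Lemma cint_unif_lim G g v : (forall n, is_cint C (G n) v) -> unif_lim G g ->
  is_cint C g v.
Proof.
move=> HG [_ Gg]; apply: cint_lim => // e e0; have [n Hn] := Gg _ e0.
by exists (G n) => // z Cz; rewrite normcB Hn.
Qed.

Hypothesis oC : counterclockwise C.
Hypothesis W0 : winding C 0 twopii.

(** Every infinite product is paired with its image under x -> ka/x; cutting both after the same n
    factors leaves the oddness to b alone. *)
Lemma cint_odd_qpoch ka c b (E : seq R[i]) : ka != 0 -> laurent_fun b ->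
  (forall x, x != 0 -> b (ka / x) = - b x) ->
  (forall e j, e \in E -> good C ka (e * q ^+ j)) ->
  is_cint C (fun x => b x * (qpoch1 q (c * x ^- 2) * qpoch1 q (c * (ka / x) ^- 2))
    / (\prod_(e <- E) (qpoch1 q (e / x) * qpoch1 q (e / (ka / x)))) / x) 0.
Proof.
move=> ka0 Lb bodd gE.
pose P n := flatten [seq [seq e * q ^+ j | j <- index_iota 0 n] | e <- E].
have polesP n x : poles (P n) x = \prod_(e <- E) (qpochn q n (e / x))^-1.
  rewrite /poles /P big_flatten big_map; apply: eq_bigr => e _.
  rewrite big_map /qpochn -prodfV; apply: eq_bigr => j _.
  by rewrite mulrAC.
have gP n p : p \in P n -> good C ka p.
  by move=> /flattenP[_ /mapP[e eE ->] /mapP[j _ ->]]; apply: gE.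
have Lm2 : laurent_fun (fun x : R[i] => c * x ^- 2).
  have := laurent_funM (laurent_fun_cst c) (laurent_funX 2 laurent_fun_inv).
  by congr laurent_fun; apply/funext => x; rewrite exprVn.
have Lp2 : laurent_fun (fun x : R[i] => c * (ka / x) ^- 2).
  have := laurent_funM (laurent_fun_cst (c * ka ^- 2)) (laurent_funX 2 laurent_fun_id).
  by congr laurent_fun; apply/funext => x; rewrite expr_div_n invf_div; ring.
have Le1 e : laurent_fun (fun x : R[i] => e / x).
  exact: laurent_funM (laurent_fun_cst e) laurent_fun_inv.
have Le2 e : laurent_fun (fun x : R[i] => e / (ka / x)).
  have := laurent_funM (laurent_fun_cst (e / ka)) laurent_fun_id.
  by congr laurent_fun; apply/funext => x; rewrite invf_div; ring.
pose h n x := b x * (qpochn q n (c * x ^- 2) * qpochn q n (c * (ka / x) ^- 2)).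
have Lh n : laurent_fun (h n).
  by apply: laurent_funM => //; apply: laurent_funM; exact: laurent_fun_qpochn.
have hodd n x : x != 0 -> h n (ka / x) = - h n x.
  move=> x0; rewrite /h bodd // kaK //; ring.
pose G n x := h n x * (\prod_(e <- E) ((qpochn q n (e / x))^-1 *
   (qpochn q n (e / (ka / x)))^-1)) * x^-1.
apply: (@cint_unif_lim G) => [n|].
  have := cint_odd jC rC oC C0 W0 ka0 (Lh n) (@gP n) (hodd n).
  by apply: cint_ext => x _; rewrite !polesP -big_split.
apply: unif_limM; last exact: unif_lim_laurent laurent_fun_inv.
apply: unif_limM.
  apply: unif_limM; first exact: unif_lim_laurent.
  by apply: unif_limM; apply: unif_lim_qpoch.
suff : unif_lim (fun n z => \prod_(e <- E) ((qpochn q n (e / z))^-1 *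
     (qpochn q n (e / (ka / z)))^-1))
   (fun z => \prod_(e <- E) ((qpoch1 q (e / z))^-1 * (qpoch1 q (e / (ka / z)))^-1)).
  congr unif_lim; apply/funext => z.
  by rewrite !big_split /= !prodfV -invfM.
elim: E gE {P polesP gP G} => [|e E IH] gE.
  have := unif_lim_laurent (laurent_fun_cst 1); congr unif_lim.
    by apply/funext => n; apply/funext => z; rewrite big_nil.
  by apply/funext => z; rewrite big_nil.
have {}IH := IH (fun e' j e'E => gE e' j (mem_behead (s := e :: E) e'E)).
suff /unif_limM/(_ IH) : unif_lim (fun n z => (qpochn q n (e / z))^-1 *
    (qpochn q n (e / (ka / z)))^-1)
  (fun z => (qpoch1 q (e / z))^-1 * (qpoch1 q (e / (ka / z)))^-1).
  congr unif_lim; last by apply/funext => z; rewrite big_cons.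
  by apply/funext => n; apply/funext => z; rewrite big_cons.
have gz z j : on_curve C z -> z != 0 /\ (z != e * q ^+ j /\ ka / z != e * q ^+ j).
  move=> /(curve_off_poles C0 ka0)[z0 /(_ _ (gE e j (mem_head _ _)))] H.
  by split.
apply: unif_limM; apply: unif_lim_qpochV => // z j /(gz _ j)[z0 [z1 z2]].
  apply: contra z1 => /eqP h1; apply/eqP; rewrite -[LHS]mulr1 -h1.
  by field.
have : ka / z != 0 by rewrite mulf_neq0 ?invr_eq0.
move: (ka / z) z2 => w z2 w0; apply: contra z2 => /eqP h1; apply/eqP; rewrite -[LHS]mulr1 -h1.
by field.
Qed.

End UniformLimits.

(** * Laurent polynomials *)

Lemma poly_eq0 (F : numFieldType) (p : {poly F}) : (forall x, p.[x] = 0) -> p = 0.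
Proof.
move=> H; apply/eqP; apply: contraT => p0.
pose rs := [seq i%:R : F | i <- iota 0 (size p)].
have := @max_poly_roots _ p rs p0; rewrite size_map size_iota ltnn; apply.
  by apply/allP => x _; rewrite rootE H.
by rewrite map_inj_uniq ?iota_uniq // => i j /eqP; rewrite eqr_nat => /eqP.
Qed.

Section Laurent.
Context {R : realType}.
Implicit Types (f g h : laurent R) (x : R[i]) (p : {poly R[i]}) (n : nat).

Lemma lev_sub f (S : {fset int}) x : (msupp f `<=` S)%fset ->
  lev f x = \sum_(j <- S) mcoeff j f * x ^ j.
Proof.
move=> fS; rewrite /lev (big_fset_incl _ fS) // => j _ /mcoeff_outdom ->.
by rewrite mul0r.
Qed.

Lemma levD f g x : lev (f + g) x = lev f x + lev g x.
Proof.
pose S := (msupp f `|` msupp g)%fset.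
rewrite (@lev_sub (f + g) S) ?msuppD_le //.
rewrite (@lev_sub f S) ?fsubsetUl // (@lev_sub g S) ?fsubsetUr //.
by rewrite -big_split; apply: eq_bigr => j _; rewrite mcoeffD mulrDl.
Qed.

Lemma levZ c f x : lev (c *: f) x = c * lev f x.
Proof.
rewrite (@lev_sub (c *: f) (msupp f)) ?msuppZ_le // mulr_sumr.
by apply: eq_bigr => j _; rewrite mcoeffZ mulrA.
Qed.

Lemma levB f g x : lev (f - g) x = lev f x - lev g x.
Proof. by rewrite levD -scaleN1r levZ mulN1r. Qed.

Lemma lev0 x : lev 0 x = 0 :> R[i].
Proof. by rewrite -[0 in LHS](scale0r 0) levZ mul0r. Qed.

Lemma lev_sum (I : Type) (r : seq I) (F : I -> laurent R) x :
  lev (\sum_(i <- r) F i) x = \sum_(i <- r) lev (F i) x.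
Proof. by elim/big_rec2: _ => [|i y1 y2 _ <-]; rewrite ?lev0 ?levD. Qed.

Lemma levU (k : int) (c : R[i]) x : lev (mkmalgU k c) x = c * x ^ k.
Proof.
rewrite (@lev_sub _ [fset k]%fset) ?msuppU_le //.
by rewrite big_seq_fset1 mcoeffUU.
Qed.

(** The bound is symmetric in j so that the reflections x -> c/x, hence T_0 and T_1, preserve it. *)
Definition deg_le n f : Prop := forall j, mcoeff j f != 0 -> (`|j| <= n)%N.

Lemma deg_le_ex f : exists n, deg_le n f.
Proof.
exists (\max_(j <- msupp f) `|j|)%N => j; rewrite mcoeff_neq0 => jf.
exact: (@leq_bigmax_seq _ _ xpredT (fun j : int => `|j|%N)).
Qed.

Lemma deg_leD n f g : deg_le n f -> deg_le n g -> deg_le n (f + g).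
Proof.
move=> Hf Hg j; rewrite mcoeffD => fg.
have [f0|/Hf //] := eqVneq (mcoeff j f) 0.
by apply: Hg; rewrite f0 add0r in fg.
Qed.

Lemma deg_leZ n c f : deg_le n f -> deg_le n (c *: f).
Proof. by move=> Hf j; rewrite mcoeffZ mulf_eq0 negb_or => /andP[_ /Hf]. Qed.

Lemma deg_leB n f g : deg_le n f -> deg_le n g -> deg_le n (f - g).
Proof. by move=> Hf Hg; rewrite -scaleN1r; apply/deg_leD/deg_leZ. Qed.

Lemma deg_le_sum n (I : Type) (r : seq I) (F : I -> laurent R) :
  (forall i, deg_le n (F i)) -> deg_le n (\sum_(i <- r) F i).
Proof.
move=> H; elim/big_rec: _ => [j|i y _]; first by rewrite mcoeff0 eqxx.
exact: deg_leD.
Qed.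

Lemma deg_leU n k (c : R[i]) : (`|k| <= n)%N -> deg_le n (mkmalgU k c).
Proof.
by move=> kn j; rewrite mcoeffU; case: (k =P j) => [<- //|_]; rewrite mulr0n eqxx.
Qed.

Lemma absz_shift n (i : 'I_n.*2.+1) : (`|i%:Z - n%:Z| <= n)%N.
Proof. by case: i => i /=; rewrite -addnn; lia. Qed.

Lemma deg_leE n f : deg_le n f ->
  f = \sum_(i < n.*2.+1) mkmalgU (i%:Z - n%:Z) (mcoeff (i%:Z - n%:Z) f).
Proof.
move=> Hf; apply/malgP => j; rewrite raddf_sum /=.
have [jn|jn] := leqP `|j| n.
  have Hi : (absz (j + n%:Z)%R < n.*2.+1)%N by rewrite -addnn; lia.
  rewrite (bigD1 (Ordinal Hi)) //= big1 => [|i /eqP ii].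
    have -> : (absz (j + n%:Z))%:Z - n%:Z = j by lia.
    by rewrite mcoeffUU addr0.
  rewrite mcoeffU; case: eqP => // E; case: ii; apply/val_inj => /=; lia.
rewrite big1 => [|i _].
  by apply/eqP; apply: contraT => /Hf; rewrite leqNgt jn.
rewrite mcoeffU; case: eqP => // E; have := absz_shift i; rewrite E leqNgt jn //.
Qed.

Definition lpoly n f : {poly R[i]} :=
  \poly_(i < n.*2.+1) mcoeff (i%:Z - n%:Z) f.

Lemma lev_lpoly n f x : deg_le n f -> x != 0 -> lev f x = x ^- n * (lpoly n f).[x].
Proof.
move=> Hf x0; rewrite {1}(deg_leE Hf) lev_sum horner_poly mulr_sumr.
apply: eq_bigr => i _; rewrite levU expfzDr // -invr_expz -!exprnP; ring.
Qed.

Lemma lpoly_lev n p : (size p <= n.*2.+1)%N -> exists2 f, deg_le n f &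
  forall x, x != 0 -> lev f x = x ^- n * p.[x].
Proof.
move=> sp; exists (\sum_(i < size p) mkmalgU (i%:Z - n%:Z) p`_i).
  apply: deg_le_sum => i; apply: deg_leU.
  exact: (absz_shift (widen_ord sp i)).
move=> x x0; rewrite lev_sum horner_coef mulr_sumr.
apply: eq_bigr => i _; rewrite levU expfzDr // -invr_expz -!exprnP; ring.
Qed.

(** The roots of w are the exceptional points at which the identity is not known; multiplying by X w
    gives a polynomial vanishing everywhere. *)
Lemma lev_inj (w : {poly R[i]}) f g : w != 0 ->
  (forall x, x != 0 -> w.[x] != 0 -> lev f x = lev g x) -> f = g.
Proof.
move=> w0 H; apply/eqP; rewrite -subr_eq0; apply/eqP.
have [n Hn] := deg_le_ex (f - g).
have p0 : lpoly n (f - g) = 0.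
  have : lpoly n (f - g) * ('X * w) = 0.
    apply: poly_eq0 => x; rewrite !hornerM hornerX.
    have [->|x0] := eqVneq x 0; first by rewrite mul0r mulr0.
    have [->|wx] := eqVneq w.[x] 0; first by rewrite !mulr0.
    have := lev_lpoly Hn x0; rewrite levB H // subrr => /esym/eqP.
    by rewrite mulf_eq0 invr_eq0 expf_eq0 (negbTE x0) andbF /= => /eqP ->; rewrite mul0r.
  by move/eqP; rewrite mulf_eq0 mulf_eq0 polyX_eq0 (negbTE w0) !orbF => /eqP.
rewrite (deg_leE Hn) big1 // => i _.
have := coef_poly n.*2.+1 (fun i => mcoeff (i%:Z - n%:Z) (f - g)) i.
by rewrite -/(lpoly n _) p0 coef0 ltn_ord => <-; rewrite monalgU0.
Qed.

Lemma lev_flip n f (c : R[i]) : c != 0 -> deg_le n f -> exists2 g, deg_le n g &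
  forall x, x != 0 -> lev g x = lev f (c / x).
Proof.
move=> c0 Hf; exists (\sum_(i < n.*2.+1)
  mkmalgU (n%:Z - i%:Z) (mcoeff (i%:Z - n%:Z) f * c ^ (i%:Z - n%:Z))).
  by apply: deg_le_sum => i; apply: deg_leU; rewrite distnC absz_shift.
move=> x x0; rewrite {2}(deg_leE Hf) !lev_sum; apply: eq_bigr => i _.
rewrite !levU -mulrA expfzMl exprz_inv.
by congr (_ * (_ * x ^ _)); lia.
Qed.

(* The divided difference operator common to T_0 and T_1: the numerator
   vanishes at both square roots of c. *)
Lemma div_diff n f (r al : R[i]) (B : {poly R[i]}) : r != 0 -> (size B <= 3)%N ->
  deg_le n f -> exists2 g, deg_le n g & forall x, x != 0 -> x ^+ 2 != r ^+ 2 ->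
    lev g x = al * lev f x
      + B.[x] / (x ^+ 2 - r ^+ 2) * (lev f (r ^+ 2 / x) - lev f x).
Proof.
move=> r0 sB Hf.
have [f' Hf' f'E] := lev_flip (expf_neq0 2 r0) Hf.
have Hh := deg_leB Hf' Hf.
have root_r y : y ^+ 2 = r ^+ 2 -> root (lpoly n (f' - f)) y.
  move=> yr; have y0 : y != 0 by rewrite -sqrf_eq0 yr expf_neq0.
  have := lev_lpoly Hh y0; rewrite levB f'E // -yr expr2 mulfK // subrr => /esym/eqP.
  by rewrite mulf_eq0 invr_eq0 expf_eq0 (negbTE y0) andbF.
(* Division by X^2 - r^2 lowers the degree by two and B restores at most two, so the degree bound n
   survives. *)
have [Q HQ sQ] : exists2 Q : {poly R[i]},
    lpoly n (f' - f) = Q * ('X^2 - (r ^+ 2)%:P) & (size (Q * B)%R <= n.*2.+1)%N.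
  have [E|nz] := eqVneq (lpoly n (f' - f)) 0.
    by exists 0; rewrite ?E mul0r ?size_poly0.
  have rr : uniq_roots [:: r; - r].
    rewrite /= andbT; apply/andP; split => //; rewrite /diff_roots mulrC eqxx /=.
    rewrite unitfE -opprD oppr_eq0 -mulr2n mulrn_eq0 /=.
    by rewrite r0.
  have ar : all (root (lpoly n (f' - f))) [:: r; - r].
    by rewrite /= !root_r // sqrrN.
  have [Q EQ] := uniq_roots_prod_XsubC ar rr.
  have E2 : \prod_(z <- [:: r; - r]) ('X - z%:P) = 'X^2 - (r ^+ 2)%:P.
    by rewrite !big_cons big_nil mulr1 polyCN opprK rmorphXn /=; ring.
  rewrite E2 in EQ; exists Q => //.
  have Q0 : Q != 0 by apply: contraNneq nz => Q0; rewrite EQ Q0 mul0r.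
  have := size_poly n.*2.+1 (fun i => mcoeff (i%:Z - n%:Z) (f' - f)).
  rewrite -/(lpoly n _) EQ (size_Mmonic Q0 (monicXnsubC _ _)) // size_XnsubC //.
  have := size_polyMleq Q B; have : (0 < size Q)%N by rewrite size_poly_gt0.
  move: sB; move: (size B) (size Q) (size (Q * B)%R) => sB sQ sQB; lia.
have [h Hdh hE] := lpoly_lev sQ.
exists (al *: f + h); first exact/deg_leD/Hdh/deg_leZ.
move=> x x0 xr; rewrite levD levZ hE // -f'E // -levB (lev_lpoly Hh) // HQ !hornerM hornerD hornerN hornerXn hornerC.
have n1 : x ^+ 2 - r ^+ 2 != 0 by rewrite subr_eq0.
by field; rewrite expf_neq0.
Qed.

End Laurent.

(** * The operators T_0, T_1 and the Askey-Wilson equation *)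

Local Opaque lev.

Section Operators.
Context {R : realType}.
Implicit Types (t : params R) (f g h : laurent R) (x s : R[i]) (n : nat).

Definition nondeg t : Prop :=
  [/\ k0 t != 0, k1 t != 0, u0 t != 0, u1 t != 0 & sq t != 0].

Lemma admissible_nondeg t : admissible t -> nondeg t.
Proof.
move=> [/andP[q0 _] [? ? ? ?] _ _]; split => //.
by move: q0; rewrite normr_gt0 expf_eq0.
Qed.

Lemma nondeg_inv t : nondeg t -> nondeg (inv_params t).
Proof. by move=> [? ? ? ? ?]; split; rewrite /= invr_eq0. Qed.

Definition T1_eq t f g := forall x : R[i], x != 0 -> x ^+ 2 != 1 ->
    lev g x = k1 t * lev f x
      + (k1 t)^-1
        * ((1 - k1 t * u1 t * x) * (1 + k1 t * (u1 t)^-1 * x) / (1 - x ^+ 2))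
        * (lev f x^-1 - lev f x).

Definition T0_eq t f g := forall x : R[i], x != 0 -> x ^+ 2 != q_ t ->
    lev g x = k0 t * lev f x
      + (k0 t)^-1
        * ((1 - sq t * k0 t * u0 t * x^-1)
           * (1 + sq t * k0 t * (u0 t)^-1 * x^-1) / (1 - q_ t * x ^- 2))
        * (lev f (q_ t * x^-1) - lev f x).

Lemma size_quadratic (c p r : R[i]) :
  (size (c *: ((1 - p *: 'X) * (1 - r *: 'X))) <= 3)%N.
Proof.
apply: (leq_trans (size_scale_leq _ _)); apply: (leq_trans (size_polyMleq _ _)).
have H z : (size (1 - z *: 'X : {poly R[i]})%R <= 2)%N.
  apply: (leq_trans (size_polyD _ _)); rewrite size_poly1 size_polyN geq_max /=.
  by apply: (leq_trans (size_scale_leq _ _)); rewrite size_polyX.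
by have := H p; have := H r; move: (size _) (size _) => a b; lia.
Qed.

Lemma size_quadratic' (c p r : R[i]) :
  (size (c *: (('X - p%:P) * ('X - r%:P))) <= 3)%N.
Proof.
apply: (leq_trans (size_scale_leq _ _)); apply: (leq_trans (size_polyMleq _ _)).
by rewrite !size_XsubC.
Qed.

Lemma XnsubC_neq0 (c : R[i]) n : 'X^(n.+1) - c%:P != 0.
Proof. by rewrite -size_poly_eq0 size_XnsubC. Qed.

Lemma T1_ex t n f : nondeg t -> deg_le n f -> exists2 g, deg_le n g & T1_eq t f g.
Proof.
move=> [_ k10 _ u10 _] Hf.
(* The minus sign turns the denominator 1 - x^2 into x^2 - 1. *)
have [g Hg gE] := div_diff (k1 t) (oner_neq0 _)
  (size_quadratic (- (k1 t)^-1) (k1 t * u1 t) (- (k1 t / u1 t))) Hf.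
exists g => // x x0 x1; have x1' : x ^+ 2 != 1 ^+ 2 by rewrite expr1n.
rewrite (gE _ x0 x1') expr1n div1r; move: (lev f _) (lev f _) => A B.
have n1 : x ^+ 2 - 1 != 0 by rewrite subr_eq0.
have n2 : 1 - x ^+ 2 != 0 by rewrite -opprB oppr_eq0.
rewrite hornerZ hornerM !hornerD !hornerN !hornerZ !hornerX !hornerC.
by field; rewrite k10 u10 n1 n2.
Qed.

Lemma T0_ex t n f : nondeg t -> deg_le n f -> exists2 g, deg_le n g & T0_eq t f g.
Proof.
move=> [k00 _ u00 _ sq0] Hf.
have [g Hg gE] := div_diff (k0 t) sq0
  (size_quadratic' (k0 t)^-1 (sq t * k0 t * u0 t) (- (sq t * k0 t / u0 t))) Hf.
exists g => // x x0 x1; rewrite gE // /q_.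
have n1 : x ^+ 2 - sq t ^+ 2 != 0 by rewrite subr_eq0.
rewrite hornerZ hornerM !hornerD !hornerN !hornerX !hornerC.
move: (lev f _) (lev f _) => A B.
by field; rewrite k00 u00 x0 n1.
Qed.

Lemma T1_uniq t f g h : T1_eq t f g -> T1_eq t f h -> g = h.
Proof.
move=> Hg Hh; apply: (@lev_inj _ ('X^2 - 1%:P)); first exact: XnsubC_neq0.
by move=> x x0; rewrite !hornerE subr_eq0 => x1; rewrite Hg // Hh.
Qed.

Lemma T0_uniq t f g h : T0_eq t f g -> T0_eq t f h -> g = h.
Proof.
move=> Hg Hh; apply: (@lev_inj _ ('X^2 - (q_ t)%:P)); first exact: XnsubC_neq0.
by move=> x x0; rewrite !hornerE subr_eq0 => x1; rewrite Hg // Hh.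
Qed.

Lemma T1_spec t n f : nondeg t -> deg_le n f ->
  T1_eq t f (T1 t f) /\ deg_le n (T1 t f).
Proof.
move=> nt Hf; have [g Hg gE] := T1_ex nt Hf.
have TE : T1_eq t f (T1 t f) by exact: (xgetI 0 gE).
by split => //; rewrite (T1_uniq TE gE).
Qed.

Lemma T0_spec t n f : nondeg t -> deg_le n f ->
  T0_eq t f (T0 t f) /\ deg_le n (T0 t f).
Proof.
move=> nt Hf; have [g Hg gE] := T0_ex nt Hf.
have TE : T0_eq t f (T0 t f) by exact: (xgetI 0 gE).
by split => //; rewrite (T0_uniq TE gE).
Qed.

Lemma T1E t f : nondeg t -> T1_eq t f (T1 t f).
Proof. by move=> nt; have [n /(T1_spec nt)[]] := deg_le_ex f. Qed.

Lemma T0E t f : nondeg t -> T0_eq t f (T0 t f).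
Proof. by move=> nt; have [n /(T0_spec nt)[]] := deg_le_ex f. Qed.

Lemma T1_linear t c f g : nondeg t -> T1 t (c *: f + g) = c *: T1 t f + T1 t g.
Proof.
move=> nt; apply: (T1_uniq (T1E _ nt)) => x x0 x1.
rewrite !(levD, levZ) !(T1E _ nt x0 x1).
by move: (lev f _) (lev f _) (lev g _) (lev g _) => A B D E; ring.
Qed.

Lemma T0_linear t c f g : nondeg t -> T0 t (c *: f + g) = c *: T0 t f + T0 t g.
Proof.
move=> nt; apply: (T0_uniq (T0E _ nt)) => x x0 x1.
rewrite !(levD, levZ) !(T0E _ nt x0 x1).
by move: (lev f _) (lev f _) (lev g _) (lev g _) => A B D E; ring.
Qed.

(** The Hecke relation (T_1 - k_1)(T_1 + 1/k_1) = 0, which also makes T_1 invertible. *)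
Lemma T1_quad t f : nondeg t ->
  T1 t (T1 t f) = (k1 t - (k1 t)^-1) *: T1 t f + f.
Proof.
move=> nt; apply: (T1_uniq (T1E _ nt)) => x x0 x1; have [_ k10 _ u10 _] := nt.
have x0' : x^-1 != 0 by rewrite invr_eq0.
have x1' : x^-1 ^+ 2 != 1 by rewrite exprVn invr_eq1.
rewrite levD levZ (T1E _ nt x0 x1) (T1E _ nt x0' x1') invrK.
have n2 : 1 - x ^+ 2 != 0 by rewrite subr_eq0 eq_sym.
have n3 : x ^+ 2 - 1 != 0 by rewrite subr_eq0.
move: (lev f _) (lev f _) => A B.
by field; rewrite k10 u10 n2 x0 n3.
Qed.

Lemma T0_quad t f : nondeg t ->
  T0 t (T0 t f) = (k0 t - (k0 t)^-1) *: T0 t f + f.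
Proof.
move=> nt; apply: (T0_uniq (T0E _ nt)) => x x0 x1; have [k00 _ u00 _ sq0] := nt.
have q0 : q_ t != 0 by rewrite expf_neq0.
have x0' : q_ t * x^-1 != 0 by rewrite mulf_neq0 ?invr_eq0.
have n1 : x ^+ 2 - sq t ^+ 2 != 0 by rewrite subr_eq0.
have n2 : sq t ^+ 2 - x ^+ 2 != 0 by rewrite -opprB oppr_eq0.
have x1' : (q_ t * x^-1) ^+ 2 != q_ t.
  rewrite -subr_eq0 /q_ (_ : _ - _ = sq t ^+ 2 * (sq t ^+ 2 - x ^+ 2) / x ^+ 2).
    by rewrite !mulf_neq0 ?invr_eq0 ?expf_neq0.
  by field.
rewrite levD levZ (T0E _ nt x0 x1) (T0E _ nt x0' x1').
have -> : q_ t * (q_ t * x^-1)^-1 = x by rewrite invf_div mulrCA divff // mulr1.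
rewrite /q_; move: (lev f _) (lev f _) => A B.
by field; rewrite k00 u00 n1 x0 sq0 n2.
Qed.

Lemma T1_0 t : nondeg t -> T1 t 0 = 0.
Proof. by move=> nt; have := T1_linear (-1) 0 0 nt; rewrite scaler0 addr0 scaleN1r addNr. Qed.

Lemma T0_0 t : nondeg t -> T0 t 0 = 0.
Proof. by move=> nt; have := T0_linear (-1) 0 0 nt; rewrite scaler0 addr0 scaleN1r addNr. Qed.

Lemma T1Z t c f : nondeg t -> T1 t (c *: f) = c *: T1 t f.
Proof. by move=> nt; rewrite -[c *: f]addr0 T1_linear // T1_0 // addr0. Qed.

Lemma T0Z t c f : nondeg t -> T0 t (c *: f) = c *: T0 t f.
Proof. by move=> nt; rewrite -[c *: f]addr0 T0_linear // T0_0 // addr0. Qed.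

Lemma T1D t f g : nondeg t -> T1 t (f + g) = T1 t f + T1 t g.
Proof. by move=> nt; rewrite -[f]scale1r T1_linear // !scale1r. Qed.

Lemma T0D t f g : nondeg t -> T0 t (f + g) = T0 t f + T0 t g.
Proof. by move=> nt; rewrite -[f]scale1r T0_linear // !scale1r. Qed.

Lemma YD t f g : nondeg t -> Y t (f + g) = Y t f + Y t g.
Proof. by move=> nt; rewrite /Y T0D // T1D. Qed.

Lemma YZ t c f : nondeg t -> Y t (c *: f) = c *: Y t f.
Proof. by move=> nt; rewrite /Y T0Z // T1Z. Qed.

Lemma Y_eq0 t f : nondeg t -> Y t f = 0 -> f = 0.
Proof.
move=> nt Yf; have E1 := T1_quad (T0 t f) nt; have E0 := T0_quad f nt.
rewrite -/(Y t f) Yf T1_0 // scaler0 add0r in E1.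
by rewrite -E1 T0_0 // scaler0 add0r in E0.
Qed.

Lemma Y_deg_le t n f : nondeg t -> deg_le n f -> deg_le n (Y t f).
Proof. by move=> nt /(T0_spec nt)[_] /(T1_spec nt)[_]. Qed.

Definition flip_invariant f := forall x, x != 0 -> lev f x^-1 = lev f x.

(** T_1 f - k_1 f is a nonzero rational function times f(1/x) - f(x). *)
Lemma T1_flip_invariant t f : nondeg t -> T1 t f = k1 t *: f <-> flip_invariant f.
Proof.
move=> nt; have [_ k10 _ u10 _] := nt; split=> [E|Sf].
  have [n Hn] := deg_le_ex f.
  have [f' _ f'E] := lev_flip (oner_neq0 _) Hn.
  suff ff' : f' = f by move=> x x0; rewrite -[in RHS]ff' (f'E _ x0) div1r.
  apply: (@lev_inj _ (('X^2 - 1%:P) *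
    (('X - (k1 t * u1 t)^-1%:P) * ('X - (- (u1 t / k1 t))%:P)))).
    by rewrite !mulf_neq0 ?XnsubC_neq0 ?polyXsubC_eq0.
  move=> x x0; rewrite (f'E _ x0) div1r.
  rewrite !hornerM !hornerD !hornerN !hornerX !hornerC hornerXn.
  rewrite !mulf_eq0 !negb_or => /and3P[n1 n2 n3].
  have x1 : x ^+ 2 != 1 by rewrite -subr_eq0.
  have := T1E f nt x0 x1; rewrite E levZ => /esym/eqP.
  rewrite -subr_eq0 addrC addKr !mulf_eq0 !invr_eq0 (negbTE k10) /=.
  have -> : 1 - k1 t * u1 t * x = - (k1 t * u1 t) * (x - (k1 t * u1 t)^-1).
    by field; rewrite k10 u10.
  have -> : 1 + k1 t / u1 t * x = (k1 t / u1 t) * (x - - (u1 t / k1 t)).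
    by field; rewrite k10 u10.
  rewrite !mulf_eq0 !oppr_eq0 !mulf_eq0 !invr_eq0 (negbTE k10) (negbTE u10).
  rewrite (negbTE n2) (negbTE n3) /=.
  by rewrite -opprB oppr_eq0 (negbTE n1) /= subr_eq0 => /eqP.
apply: (T1_uniq (T1E _ nt)) => x x0 x1.
by rewrite levZ Sf // subrr mulr0 addr0.
Qed.

Definition aw_phi t x :=
  (1 - a_ t * x) * (1 - b_ t * x) * (1 - c_ t * x) * (1 - d_ t * x)
  / ((1 - x ^+ 2) * (1 - q_ t * x ^+ 2)).

(* The Askey-Wilson second order difference equation, with eigenvalue written
   in terms of the sum s of an eigenvalue of Y and its inverse. *)
Definition aw_eq t s f : Prop := forall x,
  x != 0 -> x ^+ 2 != 1 -> x ^+ 2 != q_ t -> q_ t * x ^+ 2 != 1 ->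
  aw_phi t x * (lev f (q_ t * x) - lev f x)
    + aw_phi t x^-1 * (lev f (x / q_ t) - lev f x)
  = k0 t * k1 t * (s - k0 t * k1 t - (k0 t * k1 t)^-1) * lev f x.

Lemma aw_eqB t s f g : aw_eq t s f -> aw_eq t s g -> aw_eq t s (f - g).
Proof.
move=> Hf Hg x x0 x1 x2 x3; have hf := Hf _ x0 x1 x2 x3.
have := Hg _ x0 x1 x2 x3; rewrite !levB; move: hf.
move: (aw_phi t x) (aw_phi t x^-1) (_ * (_ - _ - _)) => A B D.
move: (lev f _) (lev f _) (lev f _) (lev g _) (lev g _) (lev g _) => F1 F2 F3 G1 G2 G3.
by move=> Ef Eg; rewrite [RHS]mulrBr -Ef -Eg; ring.
Qed.

(** Inverting the parameters inverts a, b, c, d and q. As abcd/q = (k_0 k_1)^2, this turns phi(x)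
    into (k_0 k_1)^-2 phi(1/x) and swaps the shifts, so the two terms trade places; the eigenvalue
    acquires the same factor. *)
Lemma aw_eq_inv t s f : nondeg t -> aw_eq (inv_params t) s f -> aw_eq t s f.
Proof.
move=> nt H x x0 x1 x2 x3; have [k00 k10 u00 u10 sq0] := nt.
have q0 : q_ t != 0 by rewrite expf_neq0.
have qi : q_ (inv_params t) = (q_ t)^-1 by rewrite /q_ exprVn.
have x2' : x ^+ 2 != q_ (inv_params t).
  by apply: contra x3 => /eqP ->; rewrite qi divff.
have x3' : q_ (inv_params t) * x ^+ 2 != 1.
  apply: contra x2; rewrite qi => /eqP h.
  by rewrite -[x ^+ 2](mulVKf q0) h mulr1.
have := H _ x0 x1 x2' x3'; rewrite qi invrK.
have n1 : 1 - x ^+ 2 != 0 by rewrite subr_eq0 eq_sym.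
have n1' : x ^+ 2 - 1 != 0 by rewrite subr_eq0.
have n2 : 1 - q_ t * x ^+ 2 != 0 by rewrite subr_eq0 eq_sym.
have n2' : q_ t * x ^+ 2 - 1 != 0 by rewrite subr_eq0.
have n3 : x ^+ 2 - q_ t != 0 by rewrite subr_eq0.
have n3' : q_ t - x ^+ 2 != 0 by rewrite -opprB oppr_eq0.
have -> : aw_phi (inv_params t) x = (k0 t * k1 t) ^- 2 * aw_phi t x^-1.
  rewrite /aw_phi /a_ /b_ /c_ /d_ qi /q_ /=; rewrite /q_ in n3 n3'.
  by field; rewrite k00 k10 u00 u10 sq0 x0 n1 n1' n3 n3'.
have -> : aw_phi (inv_params t) x^-1 = (k0 t * k1 t) ^- 2 * aw_phi t x.
  rewrite /aw_phi /a_ /b_ /c_ /d_ qi /q_ /=; rewrite /q_ -exprMn in n2 n2'.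
  by field; rewrite k00 k10 u00 u10 sq0 x0 n1 n1' n2 n2'.
rewrite [(q_ t)^-1 * x]mulrC [x * q_ t]mulrC /=.
move: (aw_phi t x) (aw_phi t x^-1) (lev f _) (lev f _) (lev f _) => A B F1 F2 F3 E.
have K0 : (k0 t * k1 t) ^+ 2 != 0 by rewrite expf_neq0 ?mulf_neq0.
apply: (mulfI (invr_neq0 K0)).
transitivity ((k0 t * k1 t) ^- 2 * B * (F3 - F2) + (k0 t * k1 t) ^- 2 * A * (F1 - F2)).
  by ring.
rewrite E; by field; rewrite k00 k10.
Qed.

(* When T_1 f = k_1 f, Y + Y^{-1} acts on f as Y + k_1^{-1} T_0^{-1}, and
   T_0^{-1} = T_0 - k_0 + k_0^{-1}. *)
Lemma flip_aw_eq t s f : nondeg t -> flip_invariant f ->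
  (Y t f + (k1 t)^-1 *: (T0 t f - (k0 t - (k0 t)^-1) *: f) = s *: f <-> aw_eq t s f).
Proof.
move=> nt Sf; have [k00 k10 u00 u10 sq0] := nt.
have q0 : q_ t != 0 by rewrite expf_neq0.
have key x : x != 0 -> x ^+ 2 != 1 -> x ^+ 2 != q_ t -> q_ t * x ^+ 2 != 1 ->
  lev (Y t f + (k1 t)^-1 *: (T0 t f - (k0 t - (k0 t)^-1) *: f)) x - s * lev f x =
  (k0 t * k1 t)^-1 * (aw_phi t x * (lev f (q_ t * x) - lev f x)
    + aw_phi t x^-1 * (lev f (x / q_ t) - lev f x)
    - k0 t * k1 t * (s - k0 t * k1 t - (k0 t * k1 t)^-1) * lev f x).
  move=> x0 x1 x2 x3.
  have x0' : x^-1 != 0 by rewrite invr_eq0.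
  have x2' : x^-1 ^+ 2 != q_ t.
    by apply: contra x3 => /eqP <-; rewrite exprVn mulVf // expf_neq0.
  have xq : lev f (q_ t * x^-1) = lev f (x / q_ t).
    by rewrite -Sf ?invf_div // mulf_neq0.
  rewrite levD levZ levB levZ /Y (T1E _ nt x0 x1) (T0E _ nt x0 x2) (T0E _ nt x0' x2').
  rewrite invrK xq (Sf _ x0).
  have n1 : 1 - x ^+ 2 != 0 by rewrite subr_eq0 eq_sym.
  have n1' : x ^+ 2 - 1 != 0 by rewrite subr_eq0.
  have n2 : 1 - q_ t * x ^+ 2 != 0 by rewrite subr_eq0 eq_sym.
  have n3 : x ^+ 2 - q_ t != 0 by rewrite subr_eq0.
  rewrite /aw_phi /a_ /b_ /c_ /d_.
  move: (lev f (q_ t * x)) (lev f (x / q_ t)) (lev f x) => F1 F2 F3.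
  rewrite /q_ -exprMn in n2 *; rewrite /q_ in n3 *.
  by field; rewrite k00 k10 u00 u10 x0 n1 n1' n2 n3.
have K0 : (k0 t * k1 t)^-1 != 0 by rewrite invr_eq0 mulf_neq0.
split=> [E x x0 x1 x2 x3|E].
  have := key x x0 x1 x2 x3; rewrite E levZ subrr => /esym/eqP.
  by rewrite mulf_eq0 (negbTE K0) /= subr_eq0 => /eqP.
apply: (@lev_inj _ (('X^2 - 1%:P) * (('X^2 - (q_ t)%:P) * ('X^2 - (q_ t)^-1%:P)))).
  by rewrite !mulf_neq0 ?XnsubC_neq0.
move=> x x0; rewrite !hornerM !hornerD !hornerN !hornerXn !hornerC.
rewrite !mulf_eq0 !negb_or !subr_eq0 => /and3P[x1 x2 x3].
have {}x3 : q_ t * x ^+ 2 != 1.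
  by apply: contra x3 => /eqP h; apply/eqP; rewrite -[RHS]mulr1 -h mulKf.
by apply/eqP; rewrite levZ -subr_eq0 key // (E x x0 x1 x2 x3) subrr mulr0.
Qed.

End Operators.

(** * Symmetric Askey-Wilson polynomials *)

Section QuadraticRelation.
Variables (F : fieldType) (V : lmodType F).
Implicit Types (f g : V) (c s : F).

Variable Y : V -> V.
Hypothesis Y_lin : forall c f g, Y (c *: f + g) = c *: Y f + Y g.

Lemma lin_comb c f g : Y (f - c *: g) = Y f - c *: Y g.
Proof. by rewrite addrC -scaleNr Y_lin scaleNr addrC. Qed.

Lemma eigen_quad c s f : c * c - s * c + 1 = 0 -> Y f = c *: f ->
  Y (Y f) - s *: Y f + f = 0.
Proof.
have Y0 : Y 0 = 0 by have := Y_lin (-1) 0 0; rewrite scaler0 addr0 scaleN1r addNr.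
have YZ a g : Y (a *: g) = a *: Y g by rewrite -[a *: g]addr0 Y_lin Y0 addr0.
move=> E Yf; rewrite Yf YZ Yf !scalerA -scalerBl -[X in _ + X]scale1r -scalerDl.
by rewrite E scale0r.
Qed.

Lemma quad_lin s al be f g :
  Y (Y f) - s *: Y f + f = 0 -> Y (Y g) - s *: Y g + g = 0 ->
  Y (Y (al *: f + be *: g)) - s *: Y (al *: f + be *: g) + (al *: f + be *: g) = 0.
Proof.
have Y0 : Y 0 = 0 by have := Y_lin (-1) 0 0; rewrite scaler0 addr0 scaleN1r addNr.
have YZ a h : Y (a *: h) = a *: Y h by rewrite -[a *: h]addr0 Y_lin Y0 addr0.
move=> Ef Eg; rewrite !(Y_lin, YZ).
have -> : al *: Y (Y f) + be *: Y (Y g) - s *: (al *: Y f + be *: Y g) + (al *: f + be *: g) =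
   al *: (Y (Y f) - s *: Y f + f) + be *: (Y (Y g) - s *: Y g + g).
  rewrite !(scalerDr, scalerN) !scalerA ![s * _]mulrC opprD.
  by rewrite [X in X + (al *: f + _) = _]addrACA [LHS]addrACA.
by rewrite Ef Eg !scaler0 addr0.
Qed.

(** The quadratic relation factors as (Y - 1/c)(Y - c) f = 0. *)
Lemma quad_eigen c s f : c != 0 -> s = c + c^-1 -> Y (Y f) - s *: Y f + f = 0 ->
  Y (Y f - c *: f) = c^-1 *: (Y f - c *: f).
Proof.
move=> c0 -> E; rewrite lin_comb scalerBr scalerA mulVf // scale1r.
apply/eqP; rewrite -subr_eq0 opprB addrA addrAC -addrA -[X in _ == X]E scalerDl.
by rewrite opprD !addrA addrAC.
Qed.

Variables (T0 T1 : V -> V) (ka k1 : F).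
Hypothesis T1_lin : forall c f g, T1 (c *: f + g) = c *: T1 f + T1 g.
Hypothesis YE : forall f, Y f = T1 (T0 f).
Hypothesis T0_quad : forall f, T0 (T0 f) = ka *: T0 f + f.
Hypothesis k10 : k1 != 0.

(** T_0 f - ka f stands for T_0^-1 f, so Y sends its multiple by 1/k_1 to (1/k_1) T_1 f = f. *)
Lemma quad_T1_eigen s f : T1 f = k1 *: f ->
  Y (Y f + k1^-1 *: (T0 f - ka *: f) - s *: f) = Y (Y f) - s *: Y f + f.
Proof.
move=> Sf; rewrite lin_comb addrC [Y f + _]addrC Y_lin lin_comb.
have -> : Y (T0 f) = ka *: Y f + k1 *: f by rewrite YE T0_quad T1_lin Sf -YE.
rewrite [_ *: Y f + _]addrC addrK scalerA mulVf // scale1r.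
by rewrite addrC -addrA addrC.
Qed.

End QuadraticRelation.

Local Opaque T1 T0.

Section SymmetricPolynomials.
Context {R : realType}.
Implicit Types (t : params R) (f g h p : laurent R) (m n : nat) (j : int).

Lemma mprec_deg_lt m j : (`|j| < m)%N -> mprec j (- m%:Z) /\ mprec j m%:Z.
Proof.
case: m => // m; rewrite -NegzE /mprec /=.
case: j => n /=; rewrite ltnS => nm; split; rewrite -!addnn; lia.
Qed.

Lemma mprecnn j : mprec j j = false. Proof. exact: ltnn. Qed.

Lemma is_P_eq0 t (j : int) P h : nondeg t -> is_P t j P ->
  Y t h = gamma_ t j *: h ->
  (forall i, mcoeff i h != 0 -> mprec i j) -> h = 0.
Proof.
move=> nt [[[P1 Pl] YP] uP] Yh hl; suff /uP/eqP : leading j (P + h) /\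
    Y t (P + h) = gamma_ t j *: (P + h).
  by rewrite -subr_eq0 opprD addNKr oppr_eq0 => /eqP.
split; last by rewrite (YD _ _ nt) YP Yh scalerDr.
split=> [|i ij]; rewrite mcoeffD.
  have [->|/hl] := eqVneq (mcoeff j h) 0; first by rewrite addr0.
  by rewrite mprecnn.
have [->|/hl //] := eqVneq (mcoeff i h) 0.
by rewrite addr0; apply: Pl.
Qed.

Definition gamma_sum t m := gamma_ t m%:Z + (gamma_ t m%:Z)^-1.

Lemma gamma_neq0 t j : nondeg t -> gamma_ t j != 0.
Proof. by move=> [? ? _ _ ?]; rewrite mulf_neq0 ?expfz_neq0 ?mulf_neq0 ?expf_neq0. Qed.

(** For m = 0 the two indices coincide, so that case is treated separately. *)
Lemma gammaN t m : (0 < m)%N -> gamma_ t (- m%:Z) = (gamma_ t m%:Z)^-1.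
Proof.
case: m => // m _; rewrite /gamma_ /eps invfM !invr_expz.
by congr (_ ^ _ * _).
Qed.

Lemma gamma_sum_inv t m : gamma_sum (inv_params t) m = gamma_sum t m.
Proof.
have E : gamma_ (inv_params t) m%:Z = (gamma_ t m%:Z)^-1.
  rewrite /gamma_ /= invfM !invr_expz -exprz_inv -[in RHS]exprz_inv invfM.
  by rewrite /q_ /= exprVn.
by rewrite /gamma_sum E invrK addrC.
Qed.

Lemma Y_linear t c f g : nondeg t -> Y t (c *: f + g) = c *: Y t f + Y t g.
Proof. by move=> nt; rewrite /Y (T0_linear _ _ _ nt) (T1_linear _ _ _ nt). Qed.

Lemma Y_quad t f (s : R[i]) : nondeg t -> flip_invariant f ->
  Y t (Y t f + (k1 t)^-1 *: (T0 t f - (k0 t - (k0 t)^-1) *: f) - s *: f) =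
  Y t (Y t f) - s *: Y t f + f.
Proof.
move=> nt Sf; have [_ k10 _ _ _] := nt.
apply: (@quad_T1_eigen _ _ (Y t) _ (T0 t) (T1 t) _ _ _ _ _ k10).
- by move=> c g h; apply: Y_linear.
- by move=> c g h; apply: T1_linear.
- by [].
- by move=> g; apply: T0_quad.
- exact/(T1_flip_invariant _ nt).
Qed.

Lemma Pplus_flip_invariant t m p : nondeg t -> is_Pplus t m p -> flip_invariant p.
Proof.
move=> nt [P [P' [_ _ [[_ _ E] _]]]].
exact: (proj1 (T1_flip_invariant _ nt) E).
Qed.

(** Y has eigenvalues gamma_m and gamma_(-m) on the span containing p, so Y^2 - s Y + 1 annihilates
    p. By [Y_quad] this is Y applied to the defect of the desired equation, and Y is injective. *)
Lemma Pplus_aw t m p : nondeg t -> is_Pplus t m p -> aw_eq t (gamma_sum t m) p.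
Proof.
move=> nt Pp; have Sp := Pplus_flip_invariant nt Pp.
have [P [P' [[[_ YP] _] [[_ YP'] _] [[[al [be pE]] _ _] _]]]] := Pp.
have g0 := gamma_neq0 m%:Z nt.
apply/(flip_aw_eq _ nt Sp)/eqP; rewrite -subr_eq0; apply/eqP.
apply: (Y_eq0 nt); rewrite Y_quad //.
have lY c f g : Y t (c *: f + g) = c *: Y t f + Y t g by apply: Y_linear.
have hm : gamma_ t (- m%:Z) = gamma_ t m%:Z \/ gamma_ t (- m%:Z) = (gamma_ t m%:Z)^-1.
  by case: (m) => [|k]; [left|right; rewrite gammaN].
rewrite pE; apply: (quad_lin lY).
  by apply: (eigen_quad lY _ YP); rewrite /gamma_sum; field.
apply: (eigen_quad lY _ YP'); rewrite /gamma_sum.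
by case: hm => ->; field.
Qed.

Lemma flip_invariant_coeff g j : flip_invariant g -> mcoeff (- j) g = mcoeff j g.
Proof.
move=> Sg; have [n Hn] := deg_le_ex g.
pose g' := \sum_(i < n.*2.+1) mkmalgU (n%:Z - i%:Z) (mcoeff (i%:Z - n%:Z) g).
have gg' : g' = g.
  apply: (@lev_inj _ 1); first exact: oner_neq0.
  move=> x x0 _; rewrite -(Sg _ x0) [in RHS](deg_leE Hn) !lev_sum.
  apply: eq_bigr => i _; rewrite !levU exprz_inv; congr (_ * _ ^ _); lia.
rewrite -{1}gg' [in RHS](deg_leE Hn) !raddf_sum /=; apply: eq_bigr => i _.
rewrite !mcoeffU; congr (_ *+ _); apply/eqP/eqP; lia.
Qed.

Lemma Pplus_inv t m p p' : nondeg t ->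
  is_Pplus t m p -> is_Pplus (inv_params t) m p' -> p' = p.
Proof.
move=> nt Pp Pp'; have nt' := nondeg_inv nt.
have Sp := Pplus_flip_invariant nt Pp; have Sp' := Pplus_flip_invariant nt' Pp'.
have := aw_eq_inv nt (Pplus_aw nt' Pp'); rewrite gamma_sum_inv => A'.
have {A'} Ag := aw_eqB (Pplus_aw nt Pp) A'.
have Sg : flip_invariant (p - p') by move=> x x0; rewrite !levB (Sp _ x0) (Sp' _ x0).
have [P [P' [Pm Pmm [[_ [p1 pl] _] _]]]] := Pp.
have [_ [_ [_ _ [[_ [p1' pl'] _] _]]]] := Pp'.
(* The order alone leaves the exponent -m possible, since x^-m precedes x^m; invariance under x ->
   1/x excludes it. *)
have lt_m j : mcoeff j (p - p') != 0 -> (`|j| < m)%N.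
  have H i : mcoeff i (p - p') != 0 -> i != m%:Z /\ mprec i m%:Z.
    move=> Hi; have im : i != m%:Z.
      by apply: contraNneq Hi => ->; rewrite mcoeffB p1 p1' subrr.
    split => //; have [E|/(pl _ im) //] := eqVneq (mcoeff i p) 0.
    by apply: pl' => //; move: Hi; rewrite mcoeffB E sub0r oppr_eq0.
  move=> Hj; have [jm jlt] := H _ Hj.
  have [jm' _] : - j != m%:Z /\ mprec (- j) m%:Z by apply: H; rewrite flip_invariant_coeff.
  move: jm jm' jlt; rewrite /mprec; case: (j) => k /=; rewrite -!addnn; lia.
apply/esym/eqP; rewrite -subr_eq0; apply/eqP.
have [m0|m0] := posnP m.
  apply/malgP => j; rewrite mcoeff0; apply/eqP; apply: contraT => /lt_m.
  by rewrite m0.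
move: (p - p') Ag Sg lt_m => g Ag Sg lt_m.
have g0 := gamma_neq0 m%:Z nt.
have YYg : Y t (Y t g) - gamma_sum t m *: Y t g + g = 0.
  rewrite -(Y_quad _ nt Sg).
  have /(flip_aw_eq _ nt Sg) -> := Ag; rewrite subrr /Y (T0_0 nt).
  exact: T1_0.
have dg : deg_le m.-1 g by move=> j /lt_m jm; rewrite -ltnS prednK.
pose h := Y t g - gamma_ t m%:Z *: g.
have Yh : Y t h = gamma_ t (- m%:Z) *: h.
  rewrite gammaN //; apply: (quad_eigen _ g0 erefl YYg) => c f f'.
  exact: Y_linear.
have h0 : h = 0.
  apply: (is_P_eq0 nt Pmm Yh) => i hi.
  have : deg_le m.-1 h by apply: deg_leB; [apply: Y_deg_le|apply: deg_leZ].
  by move=> /(_ _ hi); rewrite -ltnS prednK // => /mprec_deg_lt[].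
apply: (is_P_eq0 nt Pm); first by apply/eqP; rewrite -subr_eq0 -/h h0.
by move=> i /lt_m/mprec_deg_lt[].
Qed.

(** Equality forces gamma_n = gamma_m, impossible as 0 < |q| < 1, or gamma_n = gamma_(-m), in which
    case P_n would be a nonzero eigenvector lying below x^-m. *)
Lemma gamma_sum_neq t m n p p' : admissible t -> is_Pplus t m p ->
  is_Pplus t n p' -> (n < m)%N -> gamma_sum t m != gamma_sum t n.
Proof.
move=> ht [P [P' [_ PN _]]] [Q [Q' [PQ _ _]]] nm; have nt := admissible_nondeg ht.
have gm := gamma_neq0 m%:Z nt; have gn := gamma_neq0 n%:Z nt.
have m0 : (0 < m)%N by apply: leq_ltn_trans nm.
apply/eqP => E.
have : (gamma_ t m%:Z - gamma_ t n%:Z) * (1 - (gamma_ t m%:Z * gamma_ t n%:Z)^-1) = 0.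
  transitivity (gamma_sum t m - gamma_sum t n); last by rewrite E subrr.
  by rewrite /gamma_sum; field; rewrite gm gn.
move/eqP; rewrite mulf_eq0 => /orP[|].
  have [k00 k10 _ _ sq0] := nt; have [/andP[_ q1] _ _ _] := ht.
  rewrite /gamma_ subr_eq0 => /eqP/mulfI H.
  have {}H : q_ t ^+ m = q_ t ^+ n by apply: H; rewrite expfz_neq0 ?mulf_neq0.
  have : normc (q_ t) ^+ m = normc (q_ t) ^+ n by rewrite -!normcX H.
  move: q1; rewrite normr_normc -[1]/(1%:C%C) ltcR => q1.
  have q0 : 0 < normc (q_ t) by rewrite normc_gt0 expf_neq0.
  by move/(ieexprIn q0 (negbT (lt_eqF q1))) => mn; rewrite mn ltnn in nm.
rewrite subr_eq0 => /eqP/esym/(congr1 (@GRing.inv _)); rewrite invrK invr1 => gg.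
have gE : gamma_ t n%:Z = gamma_ t (- m%:Z).
  by rewrite gammaN //; apply: (mulfI gm); rewrite gg divff.
have [[Q1 Ql] YQ] := proj1 PQ; rewrite gE in YQ.
have Q0 : Q = 0.
  apply: (is_P_eq0 nt PN YQ) => i Qi; have [->|im] := eqVneq i n%:Z.
    by case: (mprec_deg_lt (j := n%:Z) nm).
  apply: leq_trans (Ql _ im Qi) _; rewrite leq_eqVlt; apply/orP; right.
  by case: (mprec_deg_lt (j := n%:Z) nm).
by move/eqP: Q1; rewrite Q0 mcoeff0 eq_sym oner_eq0.
Qed.

End SymmetricPolynomials.

(** * Orthogonality *)

Local Opaque qpoch1.

Section Orthogonality.
Context {R : realType}.
Variables (t : params R) (C : R -> R[i]).
Hypothesis ht : admissible t.
Hypothesis hC : admissible_contour t C.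
Local Notation q := (q_ t).
Local Notation qp := (qpoch1 (q_ t)).

Let nt : nondeg t := admissible_nondeg ht.

Let q0 : q != 0.
Proof. by have [_ _ _ _ sq0] := nt; rewrite expf_neq0. Qed.

Let q1 : normc q < 1.
Proof. by have [/andP[_]] := ht; rewrite normr_normc -[1]/(1%:C%C) ltcR. Qed.

Lemma abcd_neq0 e : e \in abcd t -> e != 0.
Proof.
have [k00 k10 u00 u10 sq0] := nt.
by rewrite !inE => /or4P[] /eqP ->; rewrite ?oppr_eq0 !mulf_neq0 ?invr_eq0.
Qed.

(** Some interior point a q^k is so close to 0 that both have the same winding number. *)
Lemma winding0 : winding C 0 twopii.
Proof.
have [jC rC oC C0 hin] := hC.
have [d d0 Hd] := winding_near jC rC C0.
have [k Hk] := expr_small q1 (normc (a_ t)) d0.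
have [ia _] := hin _ k (mem_head _ _ : a_ t \in abcd t).
apply/(Hd (a_ t * q ^+ k)); last exact: oC.
by rewrite subr0 normcM normcX.
Qed.

Lemma contour_good ka e k l : e \in abcd t -> ka / (e * q ^+ k) = e^-1 * q ^- l ->
  good C ka (e * q ^+ k).
Proof.
move=> eE E; have [_ _ _ _ hin] := hC.
have [ie _] := hin _ k eE; have [_ xe] := hin _ l eE.
split; [exact: (mulf_neq0 (abcd_neq0 eE) (expf_neq0 _ q0))|exact: ie|by rewrite E].
Qed.

Lemma contour_neq0 x : on_curve C x -> x != 0.
Proof. by move=> Cx; apply/eqP => E; case: hC => _ _ _ + _; apply; rewrite -E. Qed.

Lemma contour_neq e x : e \in abcd t -> on_curve C x ->
  1 - e * x != 0 /\ 1 - e / x != 0.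
Proof.
move=> eE Cx; have [_ _ _ _ /(_ e 0%N eE)] := hC.
rewrite expr0 mulr1 invr1 mulr1 => -[[ie _] [xe _]].
have e0 := abcd_neq0 eE; have x0 := contour_neq0 Cx.
rewrite !subr_eq0; split; apply/eqP => E.
  by apply: xe; rewrite -[e^-1]mulr1 E mulKf.
by apply: ie; rewrite -[e](mulfVK x0) -E mul1r.
Qed.

Lemma laurent_fun_lev (f : laurent R) : laurent_fun (lev f).
Proof.
have [n Hn] := deg_le_ex f; exists n, (lpoly n f) => x x0.
exact: lev_lpoly.
Qed.

(* The inverse of the product of all (qex, qe/x; q)_oo: the common part of the
   denominators of Delta_+, K_1 and K_2. *)
Definition weight_core x : R[i] :=
  (qp (q * (a_ t * x)) * qp (q * (a_ t / x)) * (qp (q * (b_ t * x)) * qp (q * (b_ t / x)))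
   * (qp (q * (c_ t * x)) * qp (q * (c_ t / x))
      * (qp (q * (d_ t * x)) * qp (q * (d_ t / x)))))^-1.

Definition den_x x : R[i] :=
  ((1 - a_ t * x) * (1 - b_ t * x) * (1 - c_ t * x) * (1 - d_ t * x))^-1.

Lemma qpoch1S4 :
  (forall x, qp (a_ t * x) = (1 - a_ t * x) * qp (q * (a_ t * x))) *
  (forall x, qp (b_ t * x) = (1 - b_ t * x) * qp (q * (b_ t * x))) *
  (forall x, qp (c_ t * x) = (1 - c_ t * x) * qp (q * (c_ t * x))) *
  (forall x, qp (d_ t * x) = (1 - d_ t * x) * qp (q * (d_ t * x))).
Proof. by do !split; move=> x; apply: qpoch1S. Qed.

Lemma Delta_plusE x : Delta_plus t x =
  qp (x ^+ 2) * qp (x ^- 2) * (den_x x * den_x x^-1 * weight_core x).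
Proof.
rewrite /Delta_plus /qpoch !big_cons !big_nil /den_x /weight_core.
rewrite !qpoch1S4 !mulr1 !invfM; ring.
Qed.

Lemma prod_qp_shift x : x != 0 ->
  (\prod_(e <- abcd t) (qp (e / x) * qp (e / (q^-1 / x))))^-1 =
  den_x x^-1 * weight_core x.
Proof.
move=> x0; have E e : e / (q^-1 / x) = q * (e * x) by rewrite invf_div invrK; ring.
rewrite !big_cons !big_nil !E /den_x /weight_core !qpoch1S4 !mulr1 !invfM; ring.
Qed.

(** For ka = q the inside poles start at q e: the image of e q^(k+1) is then e^-1 q^-k. *)
Lemma prod_qp_shiftV x : x != 0 ->
  (\prod_(e <- [seq q * e | e <- abcd t]) (qp (e / x) * qp (e / (q / x))))^-1 =
  den_x x * weight_core x.
Proof.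
move=> x0; have E e : q * e / (q / x) = e * x by rewrite invf_div; field.
have E' e : q * e / x = q * (e / x) by rewrite mulrA.
rewrite big_map !big_cons !big_nil !E !E' /den_x /weight_core !qpoch1S4.
rewrite !mulr1 !invfM; ring.
Qed.

Lemma prod_qp x : x != 0 ->
  (\prod_(e <- abcd t) (qp (e / x) * qp (e / (1 / x))))^-1 =
  den_x x * den_x x^-1 * weight_core x.
Proof.
move=> x0; have E e : e / (1 / x) = e * x by rewrite invf_div divr1.
rewrite !big_cons !big_nil !E /den_x /weight_core !qpoch1S4 !mulr1 !invfM; ring.
Qed.

(** The numerator of phi cancels the first factors of the (ex; q)_oo, its denominator the first two
    factors of (x^2; q)_oo. *)
Lemma phi_den x : (forall e, e \in abcd t -> 1 - e * x != 0) ->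
  x ^+ 2 != 1 -> q * x ^+ 2 != 1 ->
  aw_phi t x * den_x x * qp (x ^+ 2) = qp (q * (q * x ^+ 2)).
Proof.
move=> H x1 x2.
have n1 : 1 - x ^+ 2 != 0 by rewrite subr_eq0 eq_sym.
have n2 : 1 - q * x ^+ 2 != 0 by rewrite subr_eq0 eq_sym.
have ha : 1 - a_ t * x != 0 by apply: H; rewrite !inE eqxx.
have hb : 1 - b_ t * x != 0 by apply: H; rewrite !inE eqxx ?orbT.
have hc : 1 - c_ t * x != 0 by apply: H; rewrite !inE eqxx ?orbT.
have hd : 1 - d_ t * x != 0 by apply: H; rewrite !inE eqxx ?orbT.
rewrite (qpoch1S q1 (x ^+ 2)) (qpoch1S q1 (q * x ^+ 2)) /aw_phi /den_x.
by field; rewrite ha hb hc hd n1 n2.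
Qed.

Lemma qp_eq0 y (k : nat) : y * q ^+ k = 1 -> qp y = 0.
Proof. exact: qpoch1_eq0. Qed.

Section Eigenfunctions.
Variables (f g : laurent R) (sf sg : R[i]).
Hypotheses (If : flip_invariant f) (Ig : flip_invariant g).
Hypotheses (Af : aw_eq t sf f) (Ag : aw_eq t sg g).

Lemma weight_identity x : on_curve C x ->
  k0 t * k1 t * (sf - sg) * (lev f x * lev g x * Delta_plus t x) =
  (lev f (q * x) * lev g x - lev f x * lev g (q * x))
    * (qp (x ^- 2) * qp (q * (q * x ^+ 2))) * (den_x x^-1 * weight_core x)
  + (lev f (x / q) * lev g x - lev f x * lev g (x / q))
    * (qp (q * (q * x ^- 2)) * qp (x ^+ 2)) * (den_x x * weight_core x).
Proof.
move=> Cx; have x0 := contour_neq0 Cx; rewrite Delta_plusE.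
have xx : x ^+ 2 != 0 by rewrite expf_neq0.
have [x1|x1] := eqVneq (x ^+ 2) 1.
  have -> : qp (x ^+ 2) = 0 by apply: (@qp_eq0 _ 0); rewrite expr0 mulr1.
  have -> : qp (x ^- 2) = 0 by apply: (@qp_eq0 _ 0); rewrite expr0 mulr1 x1 invr1.
  by rewrite !(mul0r, mulr0) addr0.
have [x2|x2] := eqVneq (x ^+ 2) q.
  have -> : qp (x ^- 2) = 0 by apply: (@qp_eq0 _ 1); rewrite expr1 x2 mulVf.
  have -> : x / q = x^-1 by rewrite -x2 expr2; field.
  by rewrite (If x0) (Ig x0) subrr !(mul0r, mulr0) addr0.
have [x3|x3] := eqVneq (q * x ^+ 2) 1.
  have -> : qp (x ^+ 2) = 0 by apply: (@qp_eq0 _ 1); rewrite expr1 mulrC.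
  have -> : q * x = x^-1.
    by apply: (mulIf x0); rewrite -mulrA -expr2 x3 mulVf.
  by rewrite (If x0) (Ig x0) subrr !(mul0r, mulr0) addr0.
have hU : aw_phi t x * den_x x * qp (x ^+ 2) = qp (q * (q * x ^+ 2)).
  by apply: phi_den => // e /contour_neq/(_ Cx)[].
have hV : aw_phi t x^-1 * den_x x^-1 * qp (x ^- 2) = qp (q * (q * x ^- 2)).
  have := @phi_den x^-1; rewrite exprVn; apply.
  - by move=> e /contour_neq/(_ Cx)[].
  - by rewrite invr_eq1.
  - by apply: contra x2 => /eqP h; rewrite -[x ^+ 2]mul1r -h mulfVK.
rewrite -hU -hV; move: (Af x0 x1 x2 x3) (Ag x0 x1 x2 x3).
set F := lev f x; set G := lev g x; set A := aw_phi t x; set A' := aw_phi t x^-1.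
set F1 := lev f _; set F2 := lev f _; set G1 := lev g _; set G2 := lev g _.
move=> hF hG.
have -> : k0 t * k1 t * (sf - sg) * (F * G * (qp (x ^+ 2) * qp (x ^- 2) *
    (den_x x * den_x x^-1 * weight_core x))) =
  ((k0 t * k1 t * (sf - k0 t * k1 t - (k0 t * k1 t)^-1) * F) * G -
   (k0 t * k1 t * (sg - k0 t * k1 t - (k0 t * k1 t)^-1) * G) * F) *
  (qp (x ^+ 2) * qp (x ^- 2) * (den_x x * den_x x^-1 * weight_core x)) by ring.
by rewrite -hF -hG; ring.
Qed.

Lemma cint_Delta_plus : sf != sg ->
  is_cint C (fun x => lev f x * lev g x^-1 * Delta_plus t x / x) 0.
Proof.
move=> sfg; have [jC rC oC C0 _] := hC; have [k00 k10 _ _ _] := nt.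
have Lf := laurent_fun_lev f; have Lg := laurent_fun_lev g.
have qi0 : q^-1 != 0 by rewrite invr_eq0.
have LB (h h' : R[i] -> R[i]) (u v : R[i]) : laurent_fun h -> laurent_fun h' -> u != 0 -> v != 0 ->
    laurent_fun (fun x => h (u * x) * h' x - h x * h' (v * x)).
  move=> Lh Lh' u0 v0.
  have := laurent_funD (laurent_funM (laurent_fun_scale u0 Lh) Lh')
    (laurent_funM (laurent_funM (laurent_fun_cst (-1)) Lh) (laurent_fun_scale v0 Lh')).
  by congr laurent_fun; apply/funext => x; ring.
have I1 := @cint_odd_qpoch R C jC rC C0 q q1 oC winding0 q^-1 1
  (fun x => lev f (q * x) * lev g x - lev f x * lev g (q * x)) (abcd t) qi0
  (LB _ _ _ _ Lf Lg q0 q0).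
have I2 := @cint_odd_qpoch R C jC rC C0 q q1 oC winding0 q (q ^+ 2)
  (fun x => lev f (q^-1 * x) * lev g x - lev f x * lev g (q^-1 * x))
  [seq q * e | e <- abcd t] q0 (LB _ _ _ _ Lf Lg qi0 qi0).
have M0 : k0 t * k1 t * (sf - sg) != 0.
  by rewrite !mulf_neq0 // subr_eq0.
have := cintZ (k0 t * k1 t * (sf - sg))^-1 (cintD (I1 _ _) (I2 _ _)).
rewrite addr0 mulr0 => H; apply: cint_ext (H _ _ _ _) => {H I1 I2} [x Cx|x x0|e k eE|x x0|e k].
- have x0 := contour_neq0 Cx; have W := weight_identity Cx.
  rewrite (Ig x0) prod_qp_shift // prod_qp_shiftV // [q^-1 * x]mulrC mul1r.
  have -> : 1 * (q^-1 / x) ^- 2 = q * (q * x ^+ 2).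
    by rewrite expr_div_n; field; rewrite x0 q0.
  have -> : q ^+ 2 * x ^- 2 = q * (q * x ^- 2) by ring.
  have -> : q ^+ 2 * (q / x) ^- 2 = x ^+ 2.
    by rewrite expr_div_n; field; rewrite x0 q0.
  by rewrite -mulrDl -W mulrA mulKf.
- have -> : q * (q^-1 / x) = x^-1 by rewrite mulrA divff // mul1r.
  have -> : q^-1 / x = (q * x)^-1 by rewrite [RHS]invfM.
  by rewrite /= !(If, Ig) //; [ring|..]; apply: mulf_neq0.
- apply: (@contour_good _ _ _ k.+1) => //; have e0 := abcd_neq0 eE.
  by rewrite exprS; field; rewrite e0 q0 expf_neq0.
- have -> : q^-1 * (q / x) = x^-1 by rewrite mulrA mulVf // mul1r.
  have -> : q / x = (q^-1 * x)^-1 by rewrite [RHS]invfM invrK.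
  by rewrite /= !(If, Ig) //; [ring|..]; apply: mulf_neq0.
move=> /mapP[e' eE ->]; have e0 := abcd_neq0 eE.
have -> : q * e' * q ^+ k = e' * q ^+ k.+1 by rewrite exprS; ring.
apply: (@contour_good _ _ _ k) => //.
by rewrite exprS; field; rewrite e0 q0 expf_neq0.
Qed.

(** The factor Delta / Delta_+ is (1 - ab)/2 plus its antisymmetric part r(x) / (2 (1 - x^2)). In
    the second term 1 - x^2 cancels against (x^2; q)_oo, while 1 - x^-2, split off from (x^-2;
    q)_oo, goes into b. *)
Lemma cint_Delta : is_cint C (fun x => lev f x * lev g x^-1 * Delta_plus t x / x) 0 ->
  is_cint C (fun x => lev f x * lev g x^-1 * Delta t x / x) 0.
Proof.
move=> I; have [jC rC oC C0 _] := hC.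
have Lf := laurent_fun_lev f; have Lg := laurent_fun_lev g.
pose r x := 2 * (a_ t + b_ t) * x - (1 + a_ t * b_ t) * (1 + x ^+ 2).
pose b x := lev f x * lev g x * (1 - x ^- 2) * r x.
have Lb : laurent_fun b.
  have L1 : laurent_fun (fun x : R[i] => 1 - x ^- 2).
    have := laurent_funD (laurent_fun_cst (1 : R[i]))
      (laurent_funM (laurent_fun_cst (-1)) (laurent_funX 2 laurent_fun_inv)).
    by congr laurent_fun; apply/funext => x; rewrite exprVn mulN1r.
  have L2 : laurent_fun r.
    have := laurent_funD (laurent_funM (laurent_fun_cst (2 * (a_ t + b_ t))) laurent_fun_id)
      (laurent_funM (laurent_fun_cst (- (1 + a_ t * b_ t)))
        (laurent_funD (laurent_fun_cst 1) (laurent_funX 2 laurent_fun_id))).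
    by rewrite /r; congr laurent_fun; apply/funext => x; ring.
  exact: laurent_funM (laurent_funM (laurent_funM Lf Lg) L1) L2.
have := @cint_odd_qpoch R C jC rC C0 q q1 oC winding0 1 q b
  (abcd t) (oner_neq0 _) Lb.
move=> J; have := cintD (cintZ ((1 - a_ t * b_ t) / 2) I) (cintZ 2^-1 (J _ _)).
rewrite !mulr0 addr0 => H; apply: cint_ext (H _ _) => {H J} [x Cx|x x0|e k eE].
- have x0 := contour_neq0 Cx; rewrite prod_qp // Delta_plusE /Delta Delta_plusE.
  rewrite (Ig x0) /b /r; have xx : x ^+ 2 != 0 by rewrite expf_neq0.
  have [x1|x1] := eqVneq (x ^+ 2) 1.
    have -> : qp (x ^+ 2) = 0 by apply: (@qp_eq0 _ 0); rewrite expr0 mulr1.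
    by rewrite x1 invr1 subrr; ring.
  have n1 : 1 - x ^+ 2 != 0 by rewrite subr_eq0 eq_sym.
  have n2 : x ^+ 2 - 1 != 0 by rewrite subr_eq0.
  have -> : (1 / x) ^- 2 = x ^+ 2 by rewrite div1r exprVn invrK.
  rewrite (qpoch1S q1 (x ^+ 2)) (qpoch1S q1 (x ^- 2)).
  move: (qp _) (qp _) (den_x x) (den_x x^-1) (weight_core x) => U V D1 D2 Z.
  move: (lev f x) (lev g x) => F G.
  by field; rewrite x0 n2.
- rewrite /b /r div1r If // Ig //; field.
  by rewrite x0.
- by apply: (@contour_good _ _ _ k) => //; rewrite div1r invfM.
Qed.

End Eigenfunctions.
End Orthogonality.

Theorem proposition6p9 (R : realType) (t : params R) (ht : admissible t) :
  (forall (m : nat) (p p' : laurent R),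
     is_Pplus t m p -> is_Pplus (inv_params t) m p' -> p' = p)
  /\
  (forall (C : R -> R[i]) (m n : nat) (pm pn : laurent R),
     admissible_contour t C -> is_Pplus t m pm -> is_Pplus t n pn -> m <> n ->
     is_form t C pm pn 0 /\ is_form_plus t C pm pn 0).
Proof.
have nt := admissible_nondeg ht; split=> [m p p'|C m n pm pn hC Pm Pn mn].
  exact: Pplus_inv.
have sn : gamma_sum t m != gamma_sum t n.
  case: (ltngtP m n) mn => // nm _; last exact: gamma_sum_neq Pm Pn nm.
  by rewrite eq_sym; exact: gamma_sum_neq Pn Pm nm.
have Im := Pplus_flip_invariant nt Pm; have In := Pplus_flip_invariant nt Pn.
have I := cint_Delta_plus ht hC Im In (Pplus_aw nt Pm) (Pplus_aw nt Pn) sn.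
split; rewrite /is_form /is_form_plus /is_pairing mulr0 //.
exact: cint_Delta.
Qed.
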